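(* Let $(M,\varphi,\xi_\alpha,\eta^\alpha,g)$ be a Lorentzian $\mathcal{S}$-manifold with $\dim(M)=2n+s$, $s\geqslant1$, where $\xi_1$ denotes the timelike characteristic vector field, and let $p\in M$. Then $M$ is $\varphi$-null Osserman with respect to $(\xi_1)_p$ if and only if the eigenvalues of the Jacobi operator $R_x\colon x^\bot\to x^\bot$, with their multiplicities, are independent of $x\in S_\varphi((\xi_1)_p)$.
   Context: All manifolds are smooth and connected. Globally framed $f$-manifolds. A globally framed $f$-manifold ($g.f.f$-manifold) $(M,\varphi,\xi_\alpha,\eta^\alpha)$, $\alpha\in\{1,\dots,s\}$, $s\ge 1$, $\dim M=2n+s$, is a manifold with a non-vanishing $(1,1)$-tensor field $\varphi$ of constant rank $2n$, vector fields $\xi_1,\dots,\xi_s$ and $1$-forms $\eta^1,\dots,\eta^s$ such that $\varphi^2=-I+\sum_{\alpha}\eta^\alpha\otimes\xi_\alpha$ and $\eta^\alpha(\xi_\beta)=\delta^\alpha_\beta$ (so $\varphi^3+\varphi=0$, $\varphi\xi_\alpha=0$, $\eta^\alpha\circ\varphi=0$, and $T_pM=\mathrm{Im}(\varphi_p)\oplus\mathrm{span}((\xi_1)_p,\dots,(\xi_s)_p)$). The $\xi_\alpha$ are the characteristic vector fields. It is normal if $[\varphi,\varphi]+2\sum_\alpha d\eta^\alpha\otimes\xi_\alpha=0$, where $[\varphi,\varphi](X,Y)=\varphi^2[X,Y]+[\varphi X,\varphi Y]-\varphi[\varphi X,Y]-\varphi[X,\varphi Y]$ and $2d\eta(X,Y)=X(\eta(Y))-Y(\eta(X))-\eta([X,Y])$.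 An indefinite metric $g$ is compatible if $g(\varphi X,\varphi Y)=g(X,Y)-\sum_\alpha\varepsilon_\alpha\eta^\alpha(X)\eta^\alpha(Y)$, where $\varepsilon_\alpha=g(\xi_\alpha,\xi_\alpha)=\pm1$; then $(M,\varphi,\xi_\alpha,\eta^\alpha,g)$ is an indefinite metric $g.f.f$-manifold. It is an indefinite $\mathcal{S}$-manifold if it is normal and $d\eta^\alpha=\Phi$ for every $\alpha$, where $\Phi(X,Y)=g(X,\varphi Y)$. It is Lorentzian if $g$ is Lorentzian (exactly one minus sign); then exactly one of the $\xi_\alpha$ is timelike, and it is always labelled $\xi_1$ (so $\varepsilon_1=-1$, $\varepsilon_\alpha=1$ for $\alpha\ge2$). Curvature convention: $R(Z,W)=[\nabla_Z,\nabla_W]-\nabla_{[Z,W]}$, $\nabla$ the Levi-Civita connection. For $x\in T_pM$ with $g_p(x,x)=\pm1$ the Jacobi operator is $R_x\colon x^\bot\to x^\bot$, $R_x(y)=R_p(y,x)x$. Null Jacobi operators. For a lightlike $u\in T_pM$ ($u\ne0$, $g_p(u,u)=0$), let $\bar u^\bot=u^\bot/\mathrm{span}(u)$ with projection $\pi\colon u^\bot\to\bar u^\bot$ and the positive definite inner product $\bar g(\pi(x),\pi(y))=g_p(x,y)$. The Jacobi operator $\bar R_u\colon\bar u^\bot\to\bar u^\bot$ is $\bar R_u(\pi(x))=\pi(R_p(x,u)u)$; it is self-adjoint. $\varphi$-celestial sphere: $S_\varphi((\xi_1)_p)=\{x\in\mathrm{Im}(\varphi_p): g_p(x,x)=1\}$.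 $\varphi$-null congruence set: $N_\varphi((\xi_1)_p)=\{(\xi_1)_p+x : x\in S_\varphi((\xi_1)_p)\}$. $M$ is $\varphi$-null Osserman with respect to $(\xi_1)_p$ if the eigenvalues of $\bar R_u$ and their multiplicities are independent of $u\in N_\varphi((\xi_1)_p)$. Multiplicities are algebraic (roots of the characteristic polynomial). *)

(* Defs.v *)
From mathcomp Require Import all_boot all_order all_algebra.
From mathcomp Require Import complex.
From mathcomp Require Import all_classical all_reals all_analysis.

Set Implicit Arguments.
Unset Strict Implicit.
Unset Printing Implicit Defensive.

Import Order.TTheory GRing.Theory Num.Theory.
Import numFieldNormedType.Exports.

Local Open Scope classical_set_scope.
Local Open Scope ring_scope.

(* Vectors are rows and linear maps act on the right:                         *)
(* a (1,1)-tensor A sends v to v *m A, a 1-form e (a column) sends v to       *)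
(* v *m e, and a bilinear form G sends (v, w) to v *m G *m w^T.               *)

Section Smooth.
Variables (R : realType) (V W : normedModType R).

(* U is always open below. *)
Fixpoint ck (k : nat) (U : set V) (f : V -> W) : Prop :=
  match k with
  | 0%N => forall x, U x -> {for x, continuous f}
  | k'.+1 => (forall x, U x -> differentiable f x) /\
             (forall v, ck k' U ('D_v f))
  end.

Definition smooth_on (U : set V) (f : V -> W) : Prop := forall k, ck k U f.

End Smooth.

Section LocalCalculus.
Variables (R : realType) (m : nat).
Local Notation E := 'rV[R]_m.
Local Notation vfield := (E -> E).
Implicit Types (X Y Z W : vfield) (x v w : E).

Definition bilin (G : 'M[R]_m) v w : R := (v *m G *m w^T) 0 0.

Definition lie X Y : vfield := fun x => 'D_(X x) Y x - 'D_(Y x) X x.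

Definition pairing (eta : E -> 'cV[R]_m) X : E -> R :=
  fun x => (X x *m eta x) 0 0.

Definition applyT (phi : E -> 'M[R]_m) X : vfield := fun x => X x *m phi x.

Definition innerT (g : E -> 'M[R]_m) X Y : E -> R :=
  fun x => bilin (g x) (X x) (Y x).

(* normalised by 2 d(eta)(X, Y) = X(eta(Y)) - Y(eta(X)) - eta([X, Y]) *)
Definition dform (eta : E -> 'cV[R]_m) X Y : E -> R := fun x =>
  2^-1 * ('D_(X x) (pairing eta Y) x - 'D_(Y x) (pairing eta X) x
          - pairing eta (lie X Y) x).

Definition nijenhuis (phi : E -> 'M[R]_m) X Y : vfield := fun x =>
  applyT phi (applyT phi (lie X Y)) x + lie (applyT phi X) (applyT phi Y) x
  - applyT phi (lie (applyT phi X) Y) x - applyT phi (lie X (applyT phi Y)) x.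

(* Gamma i x is the matrix of the linear map nabla_(d_i) at x on constant     *)
(* fields: (Gamma i x) j k is the Christoffel symbol Gamma_ij^k.              *)
Definition cov (Gamma : 'I_m -> E -> 'M[R]_m) X Y : vfield := fun x =>
  'D_(X x) Y x + \sum_i X x 0 i *: (Y x *m Gamma i x).

Definition curvature (Gamma : 'I_m -> E -> 'M[R]_m) Z W Y : vfield := fun x =>
  cov Gamma Z (cov Gamma W Y) x - cov Gamma W (cov Gamma Z Y) x
  - cov Gamma (lie Z W) Y x.

(* R_x(z, w)v. The curvature is tensorial, so the vectors may be extended to *)
(* any local vector fields; constant ones are taken.                         *)
Definition curv_at (Gamma : 'I_m -> E -> 'M[R]_m) x z w v : E :=
  curvature Gamma (cst z) (cst w) (cst v) x.

(* y |-> R_x(y, v)v on the whole tangent space *)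
Definition jacobi_mx (Gamma : 'I_m -> E -> 'M[R]_m) x v : 'M[R]_m :=
  lin1_mx (fun y => curv_at Gamma x y v v).

End LocalCalculus.

Section JacobiOperators.
Variables (R : realType) (m : nat).
Implicit Types (G L : 'M[R]_m) (u v y : 'rV[R]_m).

(* Its row space is the orthogonal of v. *)
Definition perp G v : 'M[R]_m := kermx (G *m v^T).

Lemma perpE G v y : (y <= perp G v)%MS = (bilin G y v == 0).
Proof.
rewrite /perp /bilin sub_kermx mulmxA; apply/eqP/eqP => [-> | h].
  by rewrite mxE.
by apply/matrixP => i j; rewrite !ord1 h mxE.
Qed.

(* Matrix, in a basis of the orthogonal of v, of the restriction of L. *)
Definition perp_op G L v : 'M[R]_(\rank (perp G v)) :=
  conjmx (row_base (perp G v)) L.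

(* The quotient by span u is realised as the image of pi : y |-> y *m         *)
(* cokermx u, whose kernel is span u (submxE).                               *)
Definition bar_perp G u : 'M[R]_m := perp G u *m cokermx u.

Definition bar_map L u : 'M[R]_m := pinvmx (cokermx u) *m L *m cokermx u.

(* The defining property of the operator induced on the quotient,            *)
(* pi(y) |-> pi(L y); span u is L-stable for the Jacobi operator L of u,      *)
(* since R(u, u)u = 0.                                                        *)
Lemma bar_mapE L u y : (u *m L <= u)%MS ->
  (y *m cokermx u) *m bar_map L u = (y *m L) *m cokermx u.
Proof.
move=> uL; have kerE (d : 'rV[R]_m) : (d <= u)%MS = (d *m cokermx u == 0).
  exact: submxE.
have := mulmxKpV (submxMl y (cokermx u)); rewrite /bar_map.
move: (cokermx u) kerE => pi kerE; move: (pinvmx pi) => rho piK.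
apply/eqP; rewrite -subr_eq0 !mulmxA -!mulmxBl -kerE.
by apply: submx_trans uL; apply: submxMr; rewrite kerE mulmxBl piK subrr.
Qed.

Definition bar_op G L u : 'M[R]_(\rank (bar_perp G u)) :=
  conjmx (row_base (bar_perp G u)) (bar_map L u).

(* Algebraic multiplicity of a (possibly non-real) eigenvalue of a real      *)
(* matrix; it is 0 if l is not an eigenvalue.                                *)
Definition eigenmult (d : nat) (A : 'M[R]_d) (l : complex R) : nat :=
  mup l (map_poly (real_complex R) (char_poly A)).

End JacobiOperators.

(* A connected, Hausdorff, second countable manifold with a smooth atlas;     *)
(* param c matters only on the open set cod c.                               *)
Record manifold (R : realType) (m : nat) : Type := Manifold {
  carrier :> topologicalType;
  chart : Type;
  dom : chart -> set carrier;
  coord : chart -> carrier -> 'rV[R]_m;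
  param : chart -> 'rV[R]_m -> carrier;
  dom_open : forall c, open (dom c);
  cod_open : forall c, open (coord c @` dom c);
  coordK : forall c p, dom c p -> param c (coord c p) = p;
  coord_continuous : forall c p, dom c p -> {for p, continuous (coord c)};
  param_continuous : forall c x, (coord c @` dom c) x ->
    {for x, continuous (param c)};
  dom_cover : forall p, exists c, dom c p;
  transition_smooth : forall c c',
    smooth_on (coord c @` (dom c `&` dom c')) (coord c' \o param c);
  manifold_hausdorff : hausdorff_space carrier;
  manifold_second_countable : @second_countable carrier;
  manifold_connected : connected [set: carrier]
}.

Section Manifold.
Variables (R : realType) (m : nat) (M : manifold R m).
Implicit Types (c : chart M).
Local Notation E := 'rV[R]_m.

Definition cod c : set E := coord c @` dom c.
Definition overlap c c' : set E := coord c @` (dom c `&` dom c').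
Definition transition c c' : E -> E := coord c' \o param c.

(* A tensor field is given by its components in every chart, as functions of *)
(* the coordinates, smooth and obeying the transformation law of its type.   *)
(* The Jacobian matrix also acts on the right.                               *)
Definition vec_related c c' (X X' : E -> E) : Prop :=
  forall x, overlap c c' x ->
    X' (transition c c' x) = X x *m 'J (transition c c') x.

Definition vector_field (X : chart M -> E -> E) : Prop :=
  (forall c, smooth_on (cod c) (X c)) /\
  (forall c c', vec_related c c' (X c) (X c')).

Definition one_form (eta : chart M -> E -> 'cV[R]_m) : Prop :=
  (forall c, smooth_on (cod c) (eta c)) /\
  (forall c c' x, overlap c c' x ->
     eta c x = 'J (transition c c') x *m eta c' (transition c c' x)).

Definition tensor11 (phi : chart M -> E -> 'M[R]_m) : Prop :=
  (forall c, smooth_on (cod c) (phi c)) /\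
  (forall c c' x, overlap c c' x ->
     phi c x *m 'J (transition c c') x =
     'J (transition c c') x *m phi c' (transition c c' x)).

Definition tensor02 (g : chart M -> E -> 'M[R]_m) : Prop :=
  (forall c, smooth_on (cod c) (g c)) /\
  (forall c c' x, overlap c c' x ->
     g c x = 'J (transition c c') x *m g c' (transition c c' x)
             *m ('J (transition c c') x)^T).

Record pseudo_metric : Type := PseudoMetric {
  metric :> chart M -> E -> 'M[R]_m;
  metric_tensor : tensor02 metric;
  metric_sym : forall c x, cod c x -> (metric c x)^T = metric c x;
  metric_nondeg : forall c x, cod c x -> metric c x \in unitmx
}.

(* g has, at every point, an orthonormal basis (the rows of B) with exactly  *)
(* one timelike vector. *)
Definition lorentzian (g : pseudo_metric) : Prop :=
  forall c x, cod c x -> exists2 B : 'M[R]_m, B \in unitmx &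
    B *m g c x *m B^T =
    diag_mx (\row_j (if (j : nat) == 0%N then -1 else 1)).

Record connection : Type := Connection {
  christoffel :> chart M -> 'I_m -> E -> 'M[R]_m;
  christoffel_smooth : forall c i, smooth_on (cod c) (christoffel c i);
  (* the covariant derivative of Y along X does not depend on the chart *)
  christoffel_related : forall c c' (X X' Y Y' : E -> E),
    smooth_on (overlap c c') X -> smooth_on (overlap c' c) X' ->
    smooth_on (overlap c c') Y -> smooth_on (overlap c' c) Y' ->
    vec_related c c' X X' -> vec_related c c' Y Y' ->
    vec_related c c' (cov (christoffel c) X Y) (cov (christoffel c') X' Y')
}.

(* Tensorial identities are tested on all vector fields on chart domains. *)
Definition levi_civita (g : pseudo_metric) (nabla : connection) : Prop :=
  (forall c (X Y : E -> E), smooth_on (cod c) X -> smooth_on (cod c) Y ->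
     forall x, cod c x ->
       cov (nabla c) X Y x - cov (nabla c) Y X x = lie X Y x) /\
  (forall c (X Y Z : E -> E),
     smooth_on (cod c) X -> smooth_on (cod c) Y -> smooth_on (cod c) Z ->
     forall x, cod c x ->
       'D_(X x) (innerT (g c) Y Z) x =
       innerT (g c) (cov (nabla c) X Y) Z x +
       innerT (g c) Y (cov (nabla c) X Z) x).

End Manifold.

Section GFF.
Variables (R : realType) (n s : nat) (M : manifold R (2 * n + s)%N).
Local Notation E := 'rV[R]_(2 * n + s)%N.

Record gff : Type := Gff {
  phi : chart M -> E -> 'M[R]_(2 * n + s)%N;
  xi : 'I_s -> chart M -> E -> E;
  eta : 'I_s -> chart M -> E -> 'cV[R]_(2 * n + s)%N;
  phi_tensor : tensor11 phi;
  xi_field : forall a, vector_field (xi a);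
  eta_form : forall a, one_form (eta a);
  phi_neq0 : forall c x, cod c x -> phi c x != 0;
  phi_rank : forall c x, cod c x -> \rank (phi c x) = (2 * n)%N;
  phi_sq : forall c x, cod c x -> forall v : E,
    v *m phi c x *m phi c x =
    - v + \sum_a (v *m eta a c x) 0 0 *: xi a c x;
  eta_xi : forall c x, cod c x -> forall a b,
    (xi b c x *m eta a c x) 0 0 = (a == b)%:R
}.

Variables (F : gff) (g : pseudo_metric M).

Definition eps (a : 'I_s) (c : chart M) (x : E) : R :=
  bilin (g c x) (xi F a c x) (xi F a c x).

Definition compatible : Prop := forall c x, cod c x ->
  (forall a, eps a c x = 1 \/ eps a c x = -1) /\
  (forall v w : E,
     bilin (g c x) (v *m phi F c x) (w *m phi F c x) =
     bilin (g c x) v w - \sum_a eps a c x * (v *m eta F a c x) 0 0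
                                         * (w *m eta F a c x) 0 0).

Definition normal : Prop := forall c (X Y : E -> E),
  smooth_on (cod c) X -> smooth_on (cod c) Y -> forall x, cod c x ->
  nijenhuis (phi F c) X Y x
  + \sum_a (2 * dform (eta F a c) X Y x) *: xi F a c x = 0.

Definition contact : Prop := forall a c (X Y : E -> E),
  smooth_on (cod c) X -> smooth_on (cod c) Y -> forall x, cod c x ->
  dform (eta F a c) X Y x = innerT (g c) X (applyT (phi F c) Y) x.

Definition indefinite_S_manifold : Prop := [/\ compatible, normal & contact].

(* The timelike characteristic vector field xi_1 is the one of index 0. *)
Definition xi1 (hs : (0 < s)%N) : 'I_s := Ordinal hs.

Definition lorentzian_S_manifold (hs : (0 < s)%N) : Prop :=
  [/\ indefinite_S_manifold, lorentzian g &
      forall c x, cod c x -> eps (xi1 hs) c x < 0].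

(* From here on p lies in the domain of the chart c, and the tangent space    *)
(* at p is identified with E by means of c.                                  *)
Variables (nabla : connection M) (c : chart M) (p : M).
Let x : E := coord c p.

Definition celestial_sphere (v : E) : Prop :=
  (v <= phi F c x)%MS /\ bilin (g c x) v v = 1.

Definition null_congruence (hs : (0 < s)%N) (u : E) : Prop :=
  exists2 v, celestial_sphere v & u = xi F (xi1 hs) c x + v.

Definition jacobi_op (v : E) : 'M[R]_(\rank (perp (g c x) v)) :=
  perp_op (g c x) (jacobi_mx (nabla c) x v) v.

Definition null_jacobi_op (u : E) : 'M[R]_(\rank (bar_perp (g c x) u)) :=
  bar_op (g c x) (jacobi_mx (nabla c) x u) u.

Definition phi_null_osserman (hs : (0 < s)%N) : Prop :=
  forall u u' : E, null_congruence hs u -> null_congruence hs u' ->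
  forall l, eigenmult (null_jacobi_op u) l = eigenmult (null_jacobi_op u') l.

Definition jacobi_eigenvalues_independent : Prop :=
  forall v v' : E, celestial_sphere v -> celestial_sphere v' ->
  forall l, eigenmult (jacobi_op v) l = eigenmult (jacobi_op v') l.

End GFF.

(* Main.v *)
(** Let [u = xi_1 + v] with [v] in the phi-celestial sphere, [xib] the sum of
    the [xi_a] and [etab = g(., xib)].  On an S-manifold [nabla_X xi_a = - eps_a phi X] and
    [(nabla_X phi) Y = g(phi X, phi Y) xib + etab(Y) phi^2 X], whence
    [R(X, Y) xi_a = eps_a (etab(X) phi^2 Y - etab(Y) phi^2 X)] and, by pair symmetry,
    [R(y, u) u = R(y, v) v + etab(y) v + g(v, y) xib - phi^2 y].
    So both [y |-> R(y, v) v] and [y |-> R(y, u) u] preserve the decomposition of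
    the tangent space into [W = Im phi /\ v^perp] and the span of [v] and the [xi_a].
    On the second summand their matrices depend only on the signs [eps_a]; on [W]
    they are [A] and [A + 1].  Passing to [v^perp], resp. to [u^perp / u], divides the
    characteristic polynomial by ['X], resp. ['X^2], so each of the two
    conditions says that the spectrum of [A] does not depend on [v]. *)

Require Import Defs.
From HB Require Import structures.
From mathcomp Require Import all_boot all_order all_algebra.
From mathcomp Require Import complex.
From mathcomp Require Import all_classical all_reals all_analysis.
From mathcomp Require Import ring lra zify.

Set Implicit Arguments.
Unset Strict Implicit.
Unset Printing Implicit Defensive.

Import Order.TTheory GRing.Theory Num.Theory.
Import numFieldNormedType.Exports.

Local Open Scope ring_scope.

(** * Characteristic polynomials and invariant subspaces *)

(** The two formulas for [nabla] are consequences of the structure equations, and extracting them is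
    the bulk of the work. In one chart, the covariant derivatives of [xi_a] and of [phi] at a point
    become matrices [Q] and [P]. Differentiating identities that hold on the open chart domain, and
    testing normality and contact on constant fields, yields linear relations between [P], [Q] and
    [phi]; the rest is linear algebra in one tangent space. The formula for [nabla_X xi_a] is needed
    on the whole chart domain, because the curvature on [xi_a] comes from differentiating it once
    more.

    The space [W] changes with [v], so matrices on it cannot be compared directly, but
    multiplicities can. They enter additive identities between natural numbers, where cancellation
    replaces division of polynomials. *)

Section CharPoly.
Variable F : fieldType.

Lemma char_poly_block_lower a b (A1 : 'M[F]_a) (A3 : 'M[F]_(b, a)) (A2 : 'M[F]_b) :
  char_poly (block_mx A1 0 A3 A2) = char_poly A1 * char_poly A2.
Proof.
rewrite /char_poly /char_poly_mx map_block_mx map_mx0 scalar_mx_block.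
by rewrite opp_block_mx add_block_mx oppr0 addr0 det_lblock.
Qed.

Lemma char_poly_conj m (P L K : 'M[F]_m) :
  P \in unitmx -> P *m L = K *m P -> char_poly L = char_poly K.
Proof.
move=> Pu PL.
have dP : \det (map_mx polyC P) != 0.
  by rewrite det_map_mx polyC_eq0 -unitfE -unitmxE.
apply: (mulfI dP); rewrite /char_poly /char_poly_mx -det_mulmx mulmxBr -map_mxM PL.
by rewrite map_mxM scalar_mxC -mulmxBl det_mulmx mulrC.
Qed.

(** In the basis formed by the rows of [B] and [C] the map is block triangular: [C] need only be
    stable modulo [B]. The dimensions are tied by an equation because they will be ranks. *)
Lemma char_poly_adapted m a b (L : 'M[F]_m) (B : 'M[F]_(a, m)) (C : 'M[F]_(b, m))
    A1 A2 A3 :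
  (a + b)%N = m -> row_free (col_mx B C) ->
  B *m L = A1 *m B -> C *m L = A3 *m B + A2 *m C ->
  char_poly L = char_poly A1 * char_poly A2.
Proof.
move=> e; move: L B C; case: m / e => L B C.
rewrite row_free_unit => Pu BL CL.
rewrite -(char_poly_block_lower _ A3); apply: (char_poly_conj Pu).
by rewrite mul_col_mx mul_block_col BL CL mul0mx addr0.
Qed.

Lemma char_poly0 (A : 'M[F]_1) : A = 0 -> char_poly A = 'X.
Proof.
by move=> ->; rewrite /char_poly /char_poly_mx map_mx0 subr0 det_scalar expr1.
Qed.

End CharPoly.

(** * Operators on the orthogonal of a vector and on the null quotient *)

Section JacobiCharPoly.
Variables (R : realType) (m : nat).
Implicit Types (G L : 'M[R]_m) (u v y : 'rV[R]_m).

Lemma bilin_mx G v w : v *m G *m w^T = (bilin G v w)%:M.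
Proof. by rewrite [LHS]mx11_scalar. Qed.

Lemma rank_perp G v : G *m v^T != 0 -> (\rank (perp G v) + 1)%N = m.
Proof.
move=> Gv0; rewrite /perp mxrank_ker.
have -> : \rank (G *m v^T) = 1%N.
  rewrite -mxrank_tr rank_rV; case: eqP => // /(congr1 trmx).
  by rewrite trmxK trmx0 => e; rewrite e eqxx in Gv0.
apply: subnK; case: m G v Gv0 => // G v; rewrite [G *m _]flatmx0.
by rewrite eqxx.
Qed.

Lemma sub_perpE a G v (A : 'M[R]_(a, m)) :
  (A <= perp G v)%MS = (A *m G *m v^T == 0).
Proof. by rewrite /perp sub_kermx mulmxA. Qed.

(** A non-null [v] spans a complement of its orthogonal; [L] kills it, whence the factor ['X]. *)
Lemma char_poly_perp_op G L v :
  bilin G v v != 0 -> v *m L = 0 -> stablemx (perp G v) L ->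
  char_poly L = char_poly (perp_op G L v) * 'X.
Proof.
move=> gvv vL sL.
have vGv : v *m (G *m v^T) = (bilin G v v)%:M by rewrite mulmxA bilin_mx.
have rk : (\rank (perp G v) + 1)%N = m.
  apply: rank_perp; apply/eqP => h; move: gvv.
  by rewrite /bilin -mulmxA h mulmx0 mxE eqxx.
have BG : row_base (perp G v) *m (G *m v^T) = 0.
  by apply/eqP; rewrite mulmxA -sub_perpE eq_row_base.
rewrite -(char_poly0 (erefl (0 : 'M[R]_1))).
apply: (char_poly_adapted (B := row_base (perp G v)) (C := v) (A3 := 0) rk).
- apply: inj_row_free => w; rewrite -[w]hsubmxK mul_row_col => h.
  have := congr1 (mulmx^~ (G *m v^T)) h.
  rewrite /= mulmxDl -(mulmxA (lsubmx w)) -(mulmxA (rsubmx w)) BG vGv mulmx0 add0r !mul0mx.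
  rewrite mul_mx_scalar => /eqP; rewrite scaler_eq0 (negPf gvv) /= => /eqP w2.
  move: h; rewrite w2 mul0mx addr0 => h.
  have -> : lsubmx w = 0.
    by apply: (row_free_inj (row_base_free (perp G v))); rewrite mul0mx.
  by rewrite row_mx0.
- by rewrite /perp_op /conjmx mulmxKpV// stablemx_row_base.
- by rewrite vL !mul0mx addr0.
Qed.

Lemma bar_mapE_mx a L u (A : 'M[R]_(a, m)) : (u *m L <= u)%MS ->
  (A *m cokermx u) *m bar_map L u = (A *m L) *m cokermx u.
Proof.
by move=> uL; apply/row_matrixP => i; rewrite !row_mul bar_mapE.
Qed.

Lemma mul_cokermx_eq0 a u (A : 'M[R]_(a, m)) : A *m cokermx u = 0 ->
  exists c : 'cV_a, A = c *m u.
Proof. by move/eqP; rewrite -submxE => /submxP. Qed.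

(* [L] kills [u] and maps into its orthogonal, so it is block triangular in a
   basis made of [u], a lift of a basis of the quotient, and [z]. *)
Lemma char_poly_bar_op G L u z :
  bilin G u u = 0 -> u != 0 -> bilin G z u != 0 -> u *m L = 0 ->
  (L <= perp G u)%MS ->
  char_poly L = 'X * (char_poly (bar_op G L u) * 'X).
Proof.
move=> guu u0 gzu uL sL.
have uGu : u *m (G *m u^T) = 0.
  by rewrite mulmxA bilin_mx guu -scalemx1 scale0r.
have zGu : z *m (G *m u^T) = (bilin G z u)%:M by rewrite mulmxA bilin_mx.
have uLu : (u *m L <= u)%MS by rewrite uL sub0mx.
have rk : (\rank (perp G u) + 1)%N = m.
  apply: rank_perp; apply/eqP => h; move: gzu.
  by rewrite /bilin -mulmxA h mulmx0 mxE eqxx.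
have uperp : (u <= perp G u)%MS by rewrite sub_perpE -mulmxA uGu.
have ku : (kermx (cokermx u) :=: u)%MS.
  apply/eqmxP/andP; split; first by rewrite submxE mulmx_ker.
  by rewrite sub_kermx mulmx_coker.
have rkb : (1 + (\rank (bar_perp G u) + 1))%N = m.
  rewrite -[RHS]rk -(mxrank_mul_ker (perp G u) (cokermx u)) addnCA -addnA; congr addn.
  rewrite addnC; congr addn.
  rewrite (eqmx_trans (cap_eqmx (eqmx_refl _) ku) (capmx_idPr uperp)).
  by rewrite rank_rV u0.
set B' := row_base (bar_perp G u).
(* [D] will lift the basis [B'] of the quotient to vectors of the orthogonal of [u]. *)
have [S BS] : exists S, B' = S *m (perp G u *m cokermx u).
  by apply/submxP; rewrite eq_row_base.
pose D := S *m perp G u.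
have DG : D *m (G *m u^T) = 0.
  by apply/eqP; rewrite mulmxA -sub_perpE submxMl.
have Dk : D *m cokermx u = B' by rewrite BS mulmxA.
have [t Dt] : exists t : 'cV_(_), D *m L - bar_op G L u *m D = t *m u.
  apply: mul_cokermx_eq0; rewrite mulmxBl -bar_mapE_mx// -(mulmxA (bar_op G L u)) Dk.
  rewrite /bar_op /conjmx mulmxKpV ?subrr// stablemx_row_base.
  rewrite /bar_perp bar_mapE_mx//; apply: submxMr.
  exact: submx_trans (submxMl _ _) sL.
(* The image of [z] lies in the orthogonal of [u], so it has no component along [z]: this is the
   second factor ['X]. *)
have [q zq] : exists q, z *m L *m cokermx u = q *m B'.
  apply/submxP; rewrite eq_row_base; apply: submxMr.
  exact: submx_trans (submxMl _ _) sL.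
have [t' zt] : exists t' : 'cV_(_), z *m L - q *m D = t' *m u.
  by apply: mul_cokermx_eq0; rewrite mulmxBl -[q *m D *m _]mulmxA Dk zq subrr.
rewrite -(char_poly0 (erefl (0 : 'M[R]_1))) -(char_poly_block_lower _ q).
apply: (char_poly_adapted (B := u) (C := col_mx D z) (A3 := col_mx t t') rkb).
- apply: inj_row_free => w; rewrite -[w]hsubmxK -[rsubmx w]hsubmxK !mul_row_col.
  move: (lsubmx w) (lsubmx (rsubmx w)) (rsubmx (rsubmx w)) => a b c h.
  have := congr1 (mulmx^~ (G *m u^T)) h.
  rewrite /= !mulmxDl -(mulmxA a) -(mulmxA b) -(mulmxA c) uGu DG zGu !mulmx0 !add0r !mul0mx.
  rewrite mul_mx_scalar => /eqP; rewrite scaler_eq0 (negPf gzu) /= => /eqP c0.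
  move: h; rewrite c0 mul0mx addr0 => h.
  have := congr1 (fun A => A *m cokermx u) h.
  rewrite /= mulmxDl -(mulmxA a u) -(mulmxA b D) mulmx_coker Dk mulmx0 add0r mul0mx.
  move=> h2; have b0 : b = 0.
    by apply: (row_free_inj (row_base_free (bar_perp G u))); rewrite mul0mx.
  move: h; rewrite b0 mul0mx addr0 [a]mx11_scalar mul_scalar_mx => /eqP.
  rewrite scaler_eq0 (negPf u0) orbF => /eqP ->.
  by rewrite -scalemx1 scale0r !row_mx0.
- by rewrite uL mul0mx.
- rewrite mul_col_mx mul_col_mx mul_block_col add_col_mx !mul0mx !addr0 -Dt -zt.
  by rewrite !subrK.
Qed.

End JacobiCharPoly.

(** * Multiplicities under a scalar shift *)

Section EigenMult.
Variable R : realType.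

Lemma map_char_poly_neq0 d (A : 'M[R]_d) :
  map_poly (real_complex R) (char_poly A) != 0.
Proof. by rewrite map_poly_eq0 monic_neq0 ?char_poly_monic. Qed.

(** One inequality, for all polynomials and shifts, is enough: the opposite shift undoes the
    substitution and gives the converse. *)
Lemma mup_comp_shift (K : fieldType) (p : {poly K}) (a l : K) : p != 0 ->
  mup l (p \Po ('X - a%:P)) = mup (l - a) p.
Proof.
move=> p0.
have sh (q : {poly K}) b c :
    (q \Po ('X - b%:P)) \Po ('X - c%:P) = q \Po ('X - (b + c)%:P).
  by rewrite -comp_polyA comp_polyB comp_polyX comp_polyC polyCD opprD addrA addrAC.
have shK (q : {poly K}) b c : b + c = 0 -> (q \Po ('X - b%:P)) \Po ('X - c%:P) = q.
  by move=> bc; rewrite sh bc subr0 comp_polyXr.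
have nz (q : {poly K}) b : q != 0 -> q \Po ('X - b%:P) != 0.
  move=> q0; apply/eqP => h; move/eqP: q0; apply.
  by rewrite -(shK q b (- b)) ?subrr// h comp_poly0.
have le (q : {poly K}) b c : q != 0 -> (mup c q <= mup (c + b) (q \Po ('X - b%:P)))%N.
  move=> q0; rewrite mup_geq ?nz//.
  have : ('X - c%:P) ^+ (mup c q) %| q by rewrite -mup_geq.
  move: (mup c q) => k /dvdpP[r ->].
  rewrite comp_polyM; apply: dvdp_mull.
  rewrite rmorphXn /= comp_polyB comp_polyX comp_polyC polyCD opprD addrA.
  by rewrite addrAC dvdpp.
apply/eqP; rewrite eqn_leq; apply/andP; split.
  by have := le _ (- a) l (nz _ a p0); rewrite shK ?subrr.
by have := le p a (l - a) p0; rewrite subrK.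
Qed.

Lemma char_poly_add_scalar (F : fieldType) d (A : 'M[F]_d) (a : F) :
  char_poly (A + a%:M) = char_poly A \Po ('X - a%:P).
Proof.
rewrite /char_poly -[RHS](det_map_mx (comp_poly ('X - a%:P))); congr (\det _).
apply/matrixP => i j; rewrite !mxE rmorphB rmorphMn /= comp_polyX comp_polyC.
by rewrite polyCD opprD polyCMn mulrnBl addrA addrAC.
Qed.

Lemma eigenmult_shift d (A : 'M[R]_d) (l : complex R) :
  eigenmult (A + 1%:M) l = eigenmult A (l - 1).
Proof.
rewrite /eigenmult char_poly_add_scalar -[RHS]mup_comp_shift ?map_char_poly_neq0//.
by rewrite map_comp_poly rmorphB /= map_polyX map_polyC.
Qed.

End EigenMult.

(** * Pointwise algebra of metric f-structures *)

Section Bilin.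
Variables (R : realType) (m : nat) (G : 'M[R]_m).
Implicit Types u v w : 'rV[R]_m.

Lemma bilinDl u v w : bilin G (u + v) w = bilin G u w + bilin G v w.
Proof. by rewrite /bilin !mulmxDl mxE. Qed.

Lemma bilinDr u v w : bilin G w (u + v) = bilin G w u + bilin G w v.
Proof. by rewrite /bilin linearD mulmxDr mxE. Qed.

Lemma bilinZl a v w : bilin G (a *: v) w = a * bilin G v w.
Proof. by rewrite /bilin -!scalemxAl mxE. Qed.

Lemma bilinZr a v w : bilin G w (a *: v) = a * bilin G w v.
Proof. by rewrite /bilin linearZ -scalemxAr mxE. Qed.

Lemma bilinNl v w : bilin G (- v) w = - bilin G v w.
Proof. by rewrite -scaleN1r bilinZl mulN1r. Qed.

Lemma bilinNr v w : bilin G w (- v) = - bilin G w v.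
Proof. by rewrite -scaleN1r bilinZr mulN1r. Qed.

Lemma bilin0l w : bilin G 0 w = 0.
Proof. by rewrite /bilin !mul0mx mxE. Qed.

Lemma bilin0r w : bilin G w 0 = 0.
Proof. by rewrite /bilin trmx0 mulmx0 mxE. Qed.

Lemma bilin_suml (I : finType) (f : I -> 'rV[R]_m) w :
  bilin G (\sum_i f i) w = \sum_i bilin G (f i) w.
Proof.
by apply: (big_morph (bilin G ^~ w)) => [u v|]; rewrite ?bilinDl ?bilin0l.
Qed.

Lemma bilin_sumr (I : finType) (f : I -> 'rV[R]_m) w :
  bilin G w (\sum_i f i) = \sum_i bilin G w (f i).
Proof.
by apply: (big_morph (bilin G w)) => [u v|]; rewrite ?bilinDr ?bilin0r.
Qed.

Lemma bilinC v w : G^T = G -> bilin G v w = bilin G w v.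
Proof.
move=> Gs; rewrite /bilin -[v *m G *m w^T]trmxK [LHS]mxE !trmx_mul trmxK Gs.
by rewrite mulmxA.
Qed.

Lemma bilin_nondeg v : G \in unitmx -> (forall w, bilin G v w = 0) -> v = 0.
Proof.
move=> Gu h; apply: (can_inj (mulmxK Gu)); rewrite mul0mx.
apply/rowP => j; have := h (delta_mx 0 j); rewrite /bilin trmx_delta => e.
by rewrite [RHS]mxE -{}e -colE [RHS]mxE.
Qed.

End Bilin.

Lemma matrix_vecP (R : realType) k m (A B : 'M[R]_(k, m)) :
  (forall v : 'rV_k, v *m A = v *m B) -> A = B.
Proof. by move=> h; apply/row_matrixP => i; rewrite !rowE h. Qed.

Section FrameAlgebra.
Variables (R : realType) (n s : nat).
Local Notation m := (2 * n + s)%N.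
Variables (G phi : 'M[R]_m) (xi : 'I_s -> 'rV[R]_m) (eta : 'I_s -> 'cV[R]_m).
Local Notation eps a := (bilin G (xi a) (xi a)).
Local Notation g := (bilin G).
Local Notation xib := (\sum_a xi a).
Implicit Types (x y z v w : 'rV[R]_m) (a b c : 'I_s).

Hypothesis Gsym : G^T = G.
Hypothesis Gunit : G \in unitmx.
Hypothesis phi_rk : \rank phi = (2 * n)%N.
Hypothesis phi2 : forall v,
  v *m phi *m phi = - v + \sum_a (v *m eta a) 0 0 *: xi a.
Hypothesis eta_xi1 : forall a b, (xi b *m eta a) 0 0 = (a == b)%:R.
Hypothesis eps1 : forall a, eps a = 1 \/ eps a = -1.
Hypothesis compat : forall v w,
  g (v *m phi) (w *m phi) =
  g v w - \sum_a eps a * (v *m eta a) 0 0 * (w *m eta a) 0 0.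

Local Notation Xi := (\matrix_a xi a).

Lemma mul_frame (c : 'rV_s) : c *m Xi = \sum_a c 0 a *: xi a.
Proof. by rewrite mulmx_sum_row; apply: eq_bigr => a _; rewrite rowK. Qed.

Lemma eta_frame (c : 'rV_s) b : (c *m Xi *m eta b) 0 0 = c 0 b.
Proof.
rewrite mul_frame mulmx_suml summxE (bigD1 b)//= -scalemxAl mxE eta_xi1 eqxx mulr1.
rewrite big1 ?addr0// => a ab.
by rewrite -scalemxAl mxE eta_xi1 eq_sym (negPf ab) mulr0.
Qed.

Lemma frame_row_free : row_free Xi.
Proof.
apply: inj_row_free => c h; apply/rowP => b.
by rewrite -eta_frame h mul0mx !mxE.
Qed.

(** By [phi2] the kernel of [phi] lies in the span of the frame. The rank of [phi] makes that kernel
    [s]-dimensional, so it is the whole span. *)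
Lemma xi_phi a : xi a *m phi = 0.
Proof.
have sub : (kermx phi <= Xi)%MS.
  apply/rV_subP => v; rewrite sub_kermx => /eqP v0; apply/submxP.
  exists (\row_a (v *m eta a) 0 0); rewrite mul_frame.
  have := phi2 v; rewrite v0 mul0mx => /eqP; rewrite eq_sym addrC subr_eq0 => /eqP e.
  by rewrite -[LHS]e; apply: eq_bigr => b _; rewrite [in RHS]mxE.
have : (Xi <= kermx phi)%MS.
  rewrite -(geq_leqif (mxrank_leqif_sup sub)) mxrank_ker phi_rk addKn.
  exact: rank_leq_row.
by rewrite sub_kermx => /eqP /(congr1 (row a)); rewrite row_mul rowK row0.
Qed.

Lemma phi3 v : v *m phi *m phi *m phi = - (v *m phi).
Proof.
rewrite (phi2 v) mulmxDl mulNmx mulmx_suml big1 ?addr0// => a _.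
by rewrite -scalemxAl xi_phi scaler0.
Qed.

Lemma phi_eta a v : (v *m phi *m eta a) 0 0 = 0.
Proof.
have := phi2 (v *m phi); rewrite phi3 => /esym/eqP.
rewrite -subr_eq0 addrC addrA opprK subrr add0r => /eqP h.
have := eta_frame (\row_b (v *m phi *m eta b) 0 0) a; rewrite [RHS]mxE => <-.
rewrite mul_frame; under eq_bigr do rewrite mxE.
by rewrite h mul0mx mxE.
Qed.

(** Compatibility at [v *m phi] and [w]: the square of [phi] is -1 up to frame vectors, and these
    are orthogonal to the image of [phi]. *)
Lemma phi_skew v w : g (v *m phi) w = - g v (w *m phi).
Proof.
have := compat (v *m phi) w; rewrite phi2.
rewrite [X in _ = _ - X]big1 => [|a _]; last by rewrite phi_eta mulr0 mul0r.
have xw a : g (xi a) (w *m phi) = 0.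
  have := compat (xi a) (w *m phi); rewrite xi_phi bilin0l.
  rewrite big1 ?subr0 // => b _; by rewrite phi_eta mulr0.
rewrite bilinDl bilinNl bilin_suml big1 => [|a _]; last by rewrite bilinZl xw mulr0.
by move=> h; lra.
Qed.

Lemma eta_metric a v : (v *m eta a) 0 0 = eps a * g v (xi a).
Proof.
have := compat v (xi a); rewrite xi_phi bilin0r (bigD1 a)//= eta_xi1 eqxx mulr1.
rewrite [X in _ - (_ + X)]big1 => [|b ba]; last first.
  by rewrite eta_xi1 (negPf ba) mulr0.
rewrite addr0 => h; have -> : g v (xi a) = eps a * (v *m eta a) 0 0 by lra.
by case: (eps1 a) => ->; lra.
Qed.

Lemma xi_orth a b : g (xi a) (xi b) = (a == b)%:R * eps a.
Proof.
have := eta_metric b (xi a); rewrite eta_xi1 eq_sym.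
case: eqVneq => [->|_]; first by rewrite mul1r.
by case: (eps1 b) => -> /=; lra.
Qed.

Lemma phi_perp_xi a v : g (v *m phi) (xi a) = 0.
Proof. by rewrite phi_skew xi_phi bilin0r oppr0. Qed.

Lemma frame_split v :
  v = - (v *m phi) *m phi + \sum_a (eps a * g v (xi a)) *: xi a.
Proof.
rewrite mulNmx phi2 opprD opprK -addrA [- _ + _]addrC.
under [X in X - _]eq_bigr do rewrite -eta_metric.
by rewrite subrr addr0.
Qed.

Lemma phi_xi_eq0 v : v *m phi = 0 -> (forall a, g v (xi a) = 0) -> v = 0.
Proof.
move=> h h'; rewrite (frame_split v) h oppr0 mul0mx add0r big1// => a _.
by rewrite h' mulr0 scale0r.
Qed.

Lemma xib_xi a : g (xi a) xib = eps a.
Proof.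
rewrite bilin_sumr (bigD1 a)//= big1 ?addr0// => b; rewrite eq_sym => ab.
by rewrite xi_orth (negPf ab) mul0r.
Qed.

Lemma phi_perp_xib v : g (v *m phi) xib = 0.
Proof. by rewrite bilin_sumr big1// => a _; rewrite phi_perp_xi. Qed.

Lemma epsK a : eps a * eps a = 1.
Proof. by case: (eps1 a) => ->; rewrite ?mulr1 ?mulrNN ?mul1r. Qed.

(* [v *m Q a] stands for [nabla_v xi_a], [y *m P x] for [(nabla_x phi) y] and
   [g x (y *m phi)] for the fundamental form, whose closedness is [closed]. *)
Section FirstJet.
Variables (Q : 'I_s -> 'M[R]_m) (P : 'rV[R]_m -> 'M[R]_m).
Hypothesis P_linear : forall k x y, P (k *: x + y) = k *: P x + P y.
Hypothesis P_skew : forall x y z, g (y *m P x) z = - g y (z *m P x).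
Hypothesis closed : forall x y z,
  g (y *m P x) z + g (z *m P y) x + g (x *m P z) y = 0.
Hypothesis P_xi : forall a x, xi a *m P x = - (x *m Q a *m phi).
Hypothesis P_phi3 : forall x y,
  y *m phi *m phi *m P x + y *m phi *m P x *m phi + y *m P x *m phi *m phi
  = - (y *m P x).
Hypothesis contact : forall a x y,
  g (x *m Q a) y - g x (y *m Q a) = - (2 * eps a * g (x *m phi) y).
Hypothesis Q_orth : forall a b x, g (x *m Q a) (xi b) + g (xi a) (x *m Q b) = 0.
Hypothesis normal : forall x y,
  y *m P (x *m phi) - x *m P (y *m phi) + x *m P y *m phi - y *m P x *m phi
  + (2 * g x (y *m phi)) *: xib = 0.

Lemma jet_endo0 : P 0 = 0.
Proof. by have := P_linear (-1) 0 0; rewrite scaleN1r oppr0 addr0 scaleN1r addNr. Qed.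

Lemma jet_endoD x y : P (x + y) = P x + P y.
Proof. by have := P_linear 1 x y; rewrite !scale1r. Qed.

Lemma jet_endoZ k x : P (k *: x) = k *: P x.
Proof. by have := P_linear k x 0; rewrite !addr0 jet_endo0 addr0. Qed.

(** Closedness with one slot at [xi a] trades the derivative of [phi] along [xi a] for derivatives
    evaluated on [xi a], which [P_xi] expresses by [Q]; [contact] then moves [Q a] across [g]. *)
Lemma P_at_xi a x :
  x *m P (xi a) = - (x *m Q a *m phi) - x *m phi *m Q a - (2 * eps a) *: (x *m phi *m phi).
Proof.
apply/eqP; rewrite -subr_eq0; apply/eqP; apply: (bilin_nondeg Gunit) => y.
have h1 := closed (xi a) x y.
have h2 := P_skew x y (xi a).
have h3 := contact a y (x *m phi).
have h4 := phi_skew (y *m Q a) x.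
have h5 := phi_skew y (x *m phi).
have h6 := bilinC y (x *m phi *m Q a) Gsym.
have h7 := bilinC y (x *m phi *m phi) Gsym.
have h8 := bilinC y (x *m Q a *m phi) Gsym.
rewrite !P_xi !bilinNl !bilinNr in h1 h2 *.
rewrite !(bilinDl, bilinNl, bilinZl) in h1 h2 *.
have h9 : 2 * eps a * g (y *m phi) (x *m phi) = - (2 * eps a * g (x *m phi *m phi) y).
  by rewrite h5 h7 mulrN.
lra.
Qed.

(** Normality at [x] and [xi a], rewritten through [Q]. It fixes the horizontal part of
    [nabla_(phi x) xi_a]. *)
Lemma Q_phi_phi a x : x *m phi *m Q a *m phi + eps a *: (x *m phi *m phi *m phi) = 0.
Proof.
have := normal x (xi a).
rewrite xi_phi jet_endo0 mulmx0 bilin0r mulr0 scale0r addr0 subr0 !P_xi P_at_xi.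
rewrite mulNmx opprK !mulmxDl !mulNmx -scalemxAl => h.
move: (x *m phi *m Q a *m phi) (x *m phi *m phi *m phi) h => A B /rowP h.
move: (x *m Q a *m phi *m phi) h => C h.
by apply/rowP => j; have := h j; rewrite !mxE; lra.
Qed.

(** Against a frame vector the right side of [contact] vanishes, so [Q a] moves across [g] and
    [Q_orth] applies. *)
Lemma Q_xi_sym a b : xi b *m Q a + xi a *m Q b = 0.
Proof.
apply: (bilin_nondeg Gunit) => x; rewrite bilinDl.
have h1 := contact a x (xi b); have h2 := contact b x (xi a).
have h3 := Q_orth a b x; rewrite !phi_perp_xi !mulr0 in h1 h2.
rewrite (bilinC (xi a) _ Gsym) in h3.
rewrite (bilinC _ x Gsym) (bilinC (xi a *m _) x Gsym); lra.
Qed.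

(** Normality at two frame vectors makes the horizontal part symmetric in [a] and [b], while
    [Q_xi_sym] makes it skew. *)
Lemma Q_xi_phi a b : xi b *m Q a *m phi = 0.
Proof.
have h : xi b *m Q a *m phi *m phi = 0.
  have := normal (xi a) (xi b).
  rewrite !xi_phi !jet_endo0 !mulmx0 bilin0r mulr0 scale0r addr0 subrr add0r !P_xi.
  have -> : xi a *m Q b = - (xi b *m Q a).
    by apply/eqP; rewrite -addr_eq0 addrC Q_xi_sym.
  rewrite !mulNmx !opprK -mulr2n -scaler_nat => /eqP.
  by rewrite scaler_eq0 pnatr_eq0 oppr_eq0 => /eqP.
by rewrite -[LHS]opprK -phi3 h mul0mx oppr0.
Qed.

Lemma Q_xi a b : xi b *m Q a = 0.
Proof.
apply: phi_xi_eq0 => [|c]; first exact: Q_xi_phi.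
(* The array [g (xi b *m Q a) (xi c)] is skew in (a, b) and in (a, c), hence also in (b, c), where
   [contact] makes it symmetric. *)
have skew12 a' b' c' : g (xi b' *m Q a') (xi c') = - g (xi a' *m Q b') (xi c').
  by have := congr1 (g ^~ (xi c')) (Q_xi_sym a' b'); rewrite bilinDl bilin0l; lra.
have skew13 a' b' c' : g (xi b' *m Q a') (xi c') = - g (xi b' *m Q c') (xi a').
  by have := Q_orth a' c' (xi b'); rewrite (bilinC (xi a') _ Gsym); lra.
have sym23 a' b' c' : g (xi b' *m Q a') (xi c') = g (xi c' *m Q a') (xi b').
  have := contact a' (xi b') (xi c'); rewrite xi_phi bilin0l mulr0 oppr0.
  by rewrite (bilinC (xi b') _ Gsym); lra.
have h1 := skew13 a b c; have h2 := skew12 c b a.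
have h3 := sym23 b c a; have h4 := skew12 b a c.
lra.
Qed.

(** Both [Q a] and [phi] kill the frame, so only horizontal directions matter. There [Q_phi_phi]
    gives the horizontal part, and [contact] against a frame vector shows that the vertical part is
    zero. *)
Lemma nabla_xi a x : x *m Q a = - eps a *: (x *m phi).
Proof.
have Qphi y : y *m phi *m Q a + eps a *: (y *m phi *m phi) = 0.
  apply: phi_xi_eq0 => [|b]; first by rewrite mulmxDl -scalemxAl Q_phi_phi.
  rewrite bilinDl bilinZl phi_perp_xi mulr0 addr0.
  have := contact a (y *m phi) (xi b); rewrite phi_perp_xi mulr0 oppr0.
  by rewrite (bilinC (y *m phi) _ Gsym) Q_xi bilin0l subr0.
apply/eqP; rewrite scaleNr -addr_eq0; apply/eqP.
rewrite (frame_split x) !mulmxDl scalerDr addrACA !mulmx_suml.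
rewrite [X in _ + (X + _)]big1 => [|b _]; last by rewrite -scalemxAl Q_xi scaler0.
rewrite [X in _ + (_ + _ *: X)]big1 => [|b _]; last by rewrite -scalemxAl xi_phi scaler0.
by rewrite scaler0 !addr0 Qphi.
Qed.

Lemma P_dir_xi a : P (xi a) = 0.
Proof.
apply: matrix_vecP => x; rewrite mulmx0 P_at_xi !nabla_xi -scalemxAl.
move: (x *m phi *m phi) => v; apply/rowP => j; rewrite !mxE; lra.
Qed.

Lemma P_of_xi a x : xi a *m P x = eps a *: (x *m phi *m phi).
Proof. by rewrite P_xi nabla_xi -scalemxAl scaleNr opprK. Qed.

(* As in the Kaehler case: subtract normality from the sum of closedness at
   [(phi X, Y, Z)] and at [(X, phi Y, Z)]. *)
Lemma P_horizontal x y z : g (y *m phi *m P (x *m phi)) (z *m phi) = 0.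
Proof.
pose T u v w : R := g (v *m P u) w.
have Tskew u v w : T u v w = - T u w v.
  by rewrite /T P_skew (bilinC v _ Gsym).
have Tclosed u v w : T u v w + T v w u + T w u v = 0 by exact: closed.
(* On horizontal vectors [P u] anticommutes with [phi]: this is the derivative of
   [phi^3 = - phi]. *)
have Tphi u v w : T u (v *m phi *m phi) (w *m phi) = T u (v *m phi) (w *m phi *m phi).
  have := congr1 (g ^~ (w *m phi *m phi)) (P_phi3 u (v *m phi)).
  rewrite !bilinDl bilinNl.
  have e1 : g (v *m phi *m P u *m phi *m phi) (w *m phi *m phi)
      = - g (v *m phi *m P u) (w *m phi *m phi).
    by rewrite !phi_skew opprK !phi3 bilinNr.
  have e2 : g (v *m phi *m phi *m P u *m phi) (w *m phi *m phi)
      = g (v *m phi *m phi *m P u) (w *m phi).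
    by rewrite phi_skew phi3 bilinNr opprK.
  by rewrite phi3 mulNmx bilinNl e1 e2 /T; lra.
have Tnormal u v w :
    T (u *m phi *m phi) (v *m phi) (w *m phi) - T (v *m phi *m phi) (u *m phi) (w *m phi)
    - T (v *m phi) (u *m phi) (w *m phi *m phi)
    + T (u *m phi) (v *m phi) (w *m phi *m phi) = 0.
  have := congr1 (g ^~ (w *m phi)) (normal (u *m phi) (v *m phi)).
  rewrite bilin0l !(bilinDl, bilinNl, bilinZl) (bilinC xib _ Gsym) phi_perp_xib mulr0.
  by rewrite (phi_skew (u *m phi *m _)) (phi_skew (v *m phi *m _)) /T; lra.
(* [- phi^2] is the identity on horizontal vectors, so restricting the second slot to values of
   [phi^2] loses nothing. *)
suff key u v w : T (w *m phi) (u *m phi *m phi) (v *m phi) = 0.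
  rewrite -/(T _ _ _) -[y *m phi]opprK -phi3 -mulNmx -mulNmx.
  by have := key (- (y *m phi)) z x; rewrite !mulNmx.
have h1 := Tnormal u v w.
have h2 := Tclosed (u *m phi *m phi) (v *m phi) (w *m phi).
have h3 := Tclosed (u *m phi) (v *m phi *m phi) (w *m phi).
have h4 := Tphi (v *m phi) w u; have h5 := Tphi (w *m phi) u v.
have h6 := Tphi (u *m phi) v w.
have h7 := Tskew (v *m phi *m phi) (u *m phi) (w *m phi).
have h8 := Tskew (v *m phi) (u *m phi) (w *m phi *m phi).
have h9 := Tskew (u *m phi) (v *m phi) (w *m phi *m phi).
lra.
Qed.

(** On the horizontal part of [y] the image has no horizontal component, by [P_horizontal] and
    [P_dir_xi], and skewness reduces its vertical component to [P_of_xi]. The latter also settles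
    the vertical part of [y]. *)
Lemma nabla_phi x y :
  y *m P x = g (x *m phi) (y *m phi) *: xib + g y xib *: (x *m phi *m phi).
Proof.
have hor : - (y *m phi) *m phi *m P x = g (x *m phi) (y *m phi) *: xib.
  apply/eqP; rewrite -subr_eq0; apply/eqP; apply: (bilin_nondeg Gunit) => z.
  rewrite (frame_split z) bilinDr.
  have -> : g (- (y *m phi) *m phi *m P x - g (x *m phi) (y *m phi) *: xib)
      (- (z *m phi) *m phi) = 0.
    rewrite bilinDl bilinNl bilinZl (bilinC xib _ Gsym) phi_perp_xib mulr0 subr0.
    rewrite {1}(frame_split x) jet_endoD mulmxDr bilinDl P_horizontal add0r.
    have -> : P (\sum_a (eps a * g x (xi a)) *: xi a) = 0.
      elim/big_ind: _ => [|u v hu hv|a _]; first exact: jet_endo0.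
        by rewrite jet_endoD hu hv addr0.
      by rewrite jet_endoZ P_dir_xi scaler0.
    by rewrite mulmx0 bilin0l.
  rewrite add0r bilin_sumr big1// => a _; rewrite bilinZr bilinDl bilinNl bilinZl.
  rewrite (bilinC xib _ Gsym) xib_xi P_skew P_of_xi bilinZr.
  have -> : g (- (y *m phi) *m phi) (x *m phi *m phi) = - g (x *m phi) (y *m phi).
    rewrite mulNmx bilinNl (phi_skew (y *m phi)) phi3 bilinNr opprK.
    by rewrite (bilinC _ (x *m phi) Gsym).
  by ring.
rewrite [in LHS](frame_split y) mulmxDl hor; congr (_ + _).
rewrite mulmx_suml bilin_sumr scaler_suml; apply: eq_bigr => a _.
by rewrite -scalemxAl P_of_xi scalerA mulrAC epsK mul1r.
Qed.

End FirstJet.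

(* [z *m Rm x y] stands for [R(x, y) z]. *)
Section Curvature.
Variable Rm : 'rV[R]_m -> 'rV[R]_m -> 'M[R]_m.
Hypothesis Rm_add : forall x y z, Rm x (y + z) = Rm x y + Rm x z.
Hypothesis Rm_alt : forall x y, Rm x y = - Rm y x.
Hypothesis Rm_bianchi : forall x y z, z *m Rm x y + x *m Rm y z + y *m Rm z x = 0.
Hypothesis Rm_skew : forall x y z w, g (z *m Rm x y) w = - g z (w *m Rm x y).
Hypothesis Rm_xi : forall a y z, xi a *m Rm y z =
  eps a *: (g y xib *: (z *m phi *m phi) - g z xib *: (y *m phi *m phi)).

(** The usual consequence of skewness in each pair and four Bianchi identities: the listed sign
    changes identify their terms, and linear arithmetic concludes. *)
Lemma Rm_pair x y z w : g (z *m Rm x y) w = g (x *m Rm z w) y.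
Proof.
pose r x y z w : R := g (z *m Rm x y) w.
have alt x' y' z' w' : r x' y' z' w' = - r y' x' z' w'.
  by rewrite /r Rm_alt mulmxN bilinNl.
have skew x' y' z' w' : r x' y' z' w' = - r x' y' w' z'.
  by rewrite /r Rm_skew (bilinC z' _ Gsym).
have bianchi x' y' z' w' : r x' y' z' w' + r y' z' x' w' + r z' x' y' w' = 0.
  by have := congr1 (g ^~ w') (Rm_bianchi x' y' z'); rewrite !bilinDl bilin0l.
rewrite -/(r x y z w) -/(r z w x y).
have b1 := bianchi x y z w; have b2 := bianchi y z w x.
have b3 := bianchi z w x y; have b4 := bianchi w x y z.
have := (skew z w y x, skew y z w x, alt z x y w, skew x z w y).
have := (alt w y x z, skew w y z x, skew x y w z, skew w x z y).
move=> [[[? ?] ?] ?] [[[? ?] ?] ?].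
lra.
Qed.

(** * The Jacobi operators of [v] and of [u = xi_1 + v] *)

Variables (v : 'rV[R]_m) (a1 : 'I_s) (Jv Ju : 'M[R]_m).
Hypothesis v_phi : (v <= phi)%MS.
Hypothesis v_unit : g v v = 1.
Hypothesis xi1_timelike : eps a1 = -1.
Let u := xi a1 + v.
Hypothesis JvE : forall y, y *m Jv = v *m Rm y v.
Hypothesis JuE : forall y, y *m Ju = u *m Rm y u.

Lemma horizontal_phi2 y : (y <= phi)%MS -> y *m phi *m phi = - y.
Proof. by case/submxP => h ->; rewrite phi3. Qed.

Lemma horizontal_xi y a : (y <= phi)%MS -> g y (xi a) = 0.
Proof. by case/submxP => h ->; rewrite phi_perp_xi. Qed.

Lemma horizontal_xib y : (y <= phi)%MS -> g y xib = 0.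
Proof. by case/submxP => h ->; rewrite phi_perp_xib. Qed.

Lemma xi_perp_horizontal y : (forall a, g y (xi a) = 0) -> (y <= phi)%MS.
Proof.
move=> h; rewrite (frame_split y) big1 => [|a _]; last by rewrite h mulr0 scale0r.
by rewrite addr0 submxMl.
Qed.

Lemma Rm_self x : Rm x x = 0.
Proof.
apply/matrixP => i j; have := congr1 (fun A : 'M[R]_m => A i j) (Rm_alt x x).
by rewrite /= !mxE; lra.
Qed.

Lemma Jv_perp y : g (y *m Jv) v = 0.
Proof. by rewrite JvE; have := Rm_skew y v v v; rewrite (bilinC v _ Gsym); lra. Qed.

Lemma Ju_perp y : g (y *m Ju) u = 0.
Proof. by rewrite JuE; have := Rm_skew y u u u; rewrite (bilinC u _ Gsym); lra. Qed.

Lemma Jv_v : v *m Jv = 0.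
Proof. by rewrite JvE Rm_self mulmx0. Qed.

Lemma Ju_u : u *m Ju = 0.
Proof. by rewrite JuE Rm_self mulmx0. Qed.

(** Tested against [w], pair symmetry turns [R(xi_b, v) v] into [R(v, w) xi_b], which [Rm_xi]
    evaluates. *)
Lemma Jv_xi b : xi b *m Jv = eps b *: xib.
Proof.
apply/eqP; rewrite -subr_eq0; apply/eqP; apply: (bilin_nondeg Gunit) => w.
rewrite JvE bilinDl bilinNl Rm_pair Rm_xi !bilinZl bilinDl bilinNl !bilinZl.
rewrite (horizontal_xib v_phi) (horizontal_phi2 v_phi) bilinNl v_unit.
by rewrite (bilinC xib _ Gsym); ring.
Qed.

Lemma Ju_Jv y : y *m Ju =
  y *m Jv + g y xib *: v + g v y *: xib - y *m phi *m phi.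
Proof.
(* The mixed term [R(y, xi_1) v] needs pair symmetry; the terms with the curvature applied to [xi_1]
   follow from [Rm_xi] directly. *)
have vxi : v *m Rm y (xi a1) = g v y *: xib.
  apply/eqP; rewrite -subr_eq0; apply/eqP; apply: (bilin_nondeg Gunit) => w.
  rewrite bilinDl bilinNl bilinZl Rm_pair Rm_skew Rm_xi xi1_timelike !bilinZr.
  rewrite bilinDr bilinNr !bilinZr (horizontal_xib v_phi) (horizontal_phi2 v_phi).
  by rewrite bilinNr (bilinC xib _ Gsym) (bilinC y v Gsym); ring.
rewrite JuE JvE /u Rm_add mulmxDl !mulmxDr vxi !Rm_xi xi1_timelike xib_xi.
rewrite xi1_timelike (horizontal_xib v_phi) (horizontal_phi2 v_phi) xi_phi mul0mx.
move: (v *m Rm y v) (y *m phi *m phi) => A B.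
by apply/rowP => j; rewrite !mxE; ring.
Qed.

Lemma Ju_v : v *m Ju = v + xib.
Proof.
rewrite Ju_Jv Jv_v v_unit (horizontal_xib v_phi) (horizontal_phi2 v_phi).
by rewrite scale0r add0r add0r scale1r opprK addrC.
Qed.

Lemma Ju_xi b : xi b *m Ju = eps b *: (v + xib).
Proof.
rewrite Ju_Jv Jv_xi xib_xi xi_phi mul0mx subr0 (horizontal_xi _ v_phi) scale0r.
by rewrite addr0 scalerDr addrC.
Qed.

Lemma Ju_horizontal y : (y <= phi)%MS -> g y v = 0 -> y *m Ju = y *m Jv + y.
Proof.
move=> hy yv; rewrite Ju_Jv (horizontal_xib hy) (horizontal_phi2 hy).
by rewrite (bilinC v _ Gsym) yv !scale0r !addr0 opprK.
Qed.

(** Skewness moves the curvature onto [xi a], and [R(y, v) xi_a] is zero for horizontal [y] and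
    [v]. *)
Lemma Jv_horizontal y : (y <= phi)%MS -> (y *m Jv <= phi)%MS.
Proof.
move=> hy; apply: xi_perp_horizontal => a.
rewrite JvE Rm_skew Rm_xi (horizontal_xib hy) (horizontal_xib v_phi).
by rewrite !scale0r subrr scaler0 bilin0r oppr0.
Qed.

Local Notation W := (phi :&: perp G v)%MS.
Let B := row_base W.

(** The orthogonal of [v] is a hyperplane missing [v], so its sum with the image of [phi] is the
    whole space and the intersection has dimension 2n - 1. *)
Lemma rank_W : (\rank W + (1 + s))%N = m.
Proof.
have Gv0 : G *m v^T != 0.
  apply/eqP => h; move: (oner_neq0 R); rewrite -v_unit /bilin -mulmxA h mulmx0 mxE.
  by rewrite eqxx.
have vperp : ~~ (v <= perp G v)%MS by rewrite perpE v_unit oner_eq0.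
have lt : (perp G v < phi + perp G v)%MS.
  rewrite ltmxE addsmxSr; apply: contra vperp => /(submx_trans _); apply.
  exact: submx_trans v_phi (addsmxSl _ _).
have := rank_perp Gv0; have := mxrank_sum_cap phi (perp G v).
have := rank_ltmx lt; have := rank_leq_col (phi + perp G v)%MS.
rewrite phi_rk; lia.
Qed.

Lemma W_horizontal y : (y <= W)%MS -> (y <= phi)%MS /\ g y v = 0.
Proof. by rewrite sub_capmx perpE => /andP[-> /eqP]. Qed.

Lemma W_stable : stablemx W Jv.
Proof.
apply/row_subP => i; rewrite row_mul.
have [h _] := W_horizontal (row_sub i W).
by rewrite sub_capmx (Jv_horizontal h) perpE Jv_perp eqxx.
Qed.

Let A := conjmx B Jv.

Lemma W_Jv : B *m Jv = A *m B.
Proof. by rewrite /A /conjmx mulmxKpV// stablemx_row_base W_stable. Qed.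

Lemma W_Ju : B *m Ju = (A + 1%:M) *m B.
Proof.
rewrite mulmxDl mul1mx -W_Jv; apply/row_matrixP => i; rewrite linearD /=.
rewrite (row_mul i B Ju) (row_mul i B Jv).
have /W_horizontal[h h'] : (row i B <= W)%MS.
  by apply: submx_trans (row_sub i B) _; rewrite eq_row_base.
exact: Ju_horizontal.
Qed.

(** All frame vectors go to multiples of one vector, [xib] for [Jv] and [v + xib] for [Ju]; hence
    the matrices [Kv] and [Ku] are outer products. *)
Lemma frame_mulmx (J : 'M[R]_m) w : (forall a, xi a *m J = eps a *: w) ->
  Xi *m J = (\col_a eps a) *m w.
Proof.
move=> h; apply/row_matrixP => a; rewrite !row_mul rowK h.
by rewrite [row a _]mx11_scalar mul_scalar_mx mxE mxE.
Qed.

Lemma xib_frame : xib = const_mx 1 *m Xi.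
Proof. by rewrite mul_frame; apply: eq_bigr => a _; rewrite mxE scale1r. Qed.

Let C := col_mx v Xi.

Lemma basis_free : row_free (col_mx B C).
Proof.
have vphi2 := horizontal_phi2 v_phi.
have B_phi2 : B *m phi *m phi = - B.
  apply/row_matrixP => i; rewrite row_mul (row_mul i B phi) linearN /=; apply: horizontal_phi2.
  by apply: (W_horizontal _).1; apply: submx_trans (row_sub i B) _; rewrite eq_row_base.
have Xi_phi : Xi *m phi = 0.
  by apply/row_matrixP => a; rewrite row_mul rowK xi_phi row0.
have B_v : B *m (G *m v^T) = 0.
  apply/eqP; rewrite mulmxA -sub_perpE; apply: submx_trans (capmxSr phi _).
  by rewrite eq_row_base.
apply: inj_row_free => w; rewrite -[w]hsubmxK -[rsubmx w]hsubmxK !mul_row_col.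
move: (lsubmx w) (lsubmx (rsubmx w)) (rsubmx (rsubmx w)) => a b c h.
(* [phi *m phi] kills the frame and is -1 on the other rows; pairing with [v] then isolates [b]. *)
have h1 : a *m B + b *m v = 0.
  apply: oppr_inj; rewrite oppr0.
  have := congr1 (mulmx^~ (phi *m phi)) h.
  rewrite /= !mulmxDl -(mulmxA a B) -(mulmxA b v) -(mulmxA c).
  rewrite (mulmxA B) B_phi2 (mulmxA v) vphi2 (mulmxA (\matrix_a _)) Xi_phi.
  by rewrite mul0mx mulmx0 addr0 mul0mx !mulmxN -opprD.
have b0 : b = 0.
  have := congr1 (mulmx^~ (G *m v^T)) h1.
  rewrite /= mulmxDl -(mulmxA a B) -(mulmxA b v) B_v (mulmxA v) bilin_mx v_unit.
  by rewrite mulmx0 add0r mulmx1 mul0mx.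
have a0 : a = 0.
  apply: (row_free_inj (row_base_free W)); rewrite mul0mx.
  by move: h1; rewrite b0 mul0mx addr0.
have c0 : c = 0.
  apply: (row_free_inj frame_row_free); rewrite mul0mx.
  by move: h; rewrite a0 b0 !mul0mx !add0r.
by rewrite a0 b0 c0 !row_mx0.
Qed.

(* Matrices of the two Jacobi operators on the span of [v] and the frame. *)
Let Kv : 'M[R]_(1 + s) := col_mx 0 (\col_a eps a) *m row_mx 0 (const_mx 1).
Let Ku : 'M[R]_(1 + s) := col_mx 1 (\col_a eps a) *m row_mx 1 (const_mx 1).

Lemma C_Jv : C *m Jv = Kv *m C.
Proof.
rewrite /C /Kv -mulmxA mul_row_col mul0mx add0r -xib_frame !mul_col_mx Jv_v mul0mx.
by rewrite (frame_mulmx Jv_xi).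
Qed.

Lemma C_Ju : C *m Ju = Ku *m C.
Proof.
rewrite /C /Ku -mulmxA mul_row_col -xib_frame !mul_col_mx (frame_mulmx Ju_xi).
by rewrite !mul1mx Ju_v.
Qed.

Lemma char_poly_Jv : char_poly Jv = char_poly A * char_poly Kv.
Proof.
apply: (char_poly_adapted (A3 := 0) rank_W basis_free W_Jv).
by rewrite mul0mx add0r C_Jv.
Qed.

Lemma char_poly_Ju : char_poly Ju = char_poly (A + 1%:M) * char_poly Ku.
Proof.
apply: (char_poly_adapted (A3 := 0) rank_W basis_free W_Ju).
by rewrite mul0mx add0r C_Ju.
Qed.

(** [f] counts the eigenvalues of [A], and [l - 1] reflects [A + 1]. Each [mup l 'X] stands for a
    dimension lost: one for the orthogonal of [v], two for the null quotient. *)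
Lemma jacobi_eigenmult : exists f : complex R -> nat, forall l,
  (eigenmult (perp_op G Jv v) l + mup l 'X = f l + eigenmult Kv l)%N /\
  (mup l 'X + (eigenmult (bar_op G Ju u) l + mup l 'X)
   = f (l - 1)%R + eigenmult Ku l)%N.
Proof.
exists (eigenmult A) => l.
have X0 : 'X != 0 :> {poly complex R} by rewrite polyX_eq0.
have v0 : v != 0.
  by apply/eqP => h; have := v_unit; rewrite h bilin0l => /eqP; rewrite eq_sym oner_eq0.
have uu : g u u = 0.
  rewrite /u !bilinDl !bilinDr v_unit xi1_timelike (bilinC _ v Gsym).
  by rewrite (horizontal_xi _ v_phi); lra.
(* [v] is the vector not orthogonal to [u] that [char_poly_bar_op] asks for. *)
have vu : g v u = 1 by rewrite /u bilinDr (horizontal_xi _ v_phi) v_unit add0r.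
have u0 : u != 0.
  by apply/eqP => h; move: vu; rewrite h bilin0r => /eqP; rewrite eq_sym oner_eq0.
split.
  rewrite -[LHS]mupM ?map_char_poly_neq0//.
  rewrite -[RHS]mupM ?map_char_poly_neq0// -rmorphM -char_poly_Jv.
  rewrite (@char_poly_perp_op _ _ G _ v) ?v_unit ?oner_eq0 ?Jv_v//.
    by rewrite rmorphM /= map_polyX.
  by apply/row_subP => i; rewrite row_mul perpE Jv_perp eqxx.
rewrite -eigenmult_shift -[RHS]mupM ?map_char_poly_neq0// -rmorphM -char_poly_Ju.
rewrite -[(_ + mup l _)%N]mupM ?map_char_poly_neq0//.
rewrite -[LHS]mupM ?mulf_neq0 ?map_char_poly_neq0//.
rewrite (@char_poly_bar_op _ _ G _ u v) ?vu ?oner_eq0 ?Ju_u//.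
  by rewrite !rmorphM /= map_polyX.
by apply/row_subP => i; rewrite rowE perpE Ju_perp eqxx.
Qed.

End Curvature.
End FrameAlgebra.

(** * Symmetry of second derivatives *)

Section SecondDerivative.
Variables (R : realType) (V : normedModType R).

Lemma is_derive_line (f : V -> R) (y v : V) (t df : R) :
  is_derive (t *: v + y) v f df -> is_derive t 1 (fun r : R => f (r *: v + y)) df.
Proof.
have E : (fun h : R => h^-1 *: (f ((h *: 1 + t) *: v + y) - f (t *: v + y)))
    = (fun h : R => h^-1 *: (f (h *: v + (t *: v + y)) - f (t *: v + y))).
  by apply/funext => h; rewrite [h *: 1]mulr1 scalerDl addrA.
by case=> d e; split; [rewrite /derivable E | rewrite -e /derive E].
Qed.

(* The second difference is symmetric in [v] and [w], unlike this estimate, which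
   applies the mean value theorem along [v] only. *)
Lemma second_difference (f fv : V -> R) (U : set V) (x v w : V) (e : R) :
  open U -> U x -> (forall y, U y -> is_derive y v f (fv y)) ->
  differentiable fv x -> 0 < e ->
  exists2 d : R, 0 < d & forall h : R, 0 < h < d ->
    `|f (h *: v + h *: w + x) - f (h *: v + x) - f (h *: w + x) + f x
      - h ^+ 2 * 'd fv x w| <= e * h ^+ 2.
Proof.
(* The error is collected at two points of norms at most [h * (|v| + |w|)] and [h * |v|], whence the
   2; the 1 keeps [N] positive. *)
move=> oU Ux dU dfv e0; pose N := 2 * `|v| + `|w| + 1.
have N0 : 0 < N by rewrite /N ltr_wpDl// addr_ge0// mulr_ge0.
have : \forall y \near (0 : V), U (y + x) /\
    `|fv (y + x) - fv x - 'd fv x y| <= e / N * `|y|.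
  apply: (@filterI _ _ _ (fun y => U (y + x))
    (fun y => `|fv (y + x) - fv x - 'd fv x y| <= e / N * `|y|)).
    have /nbhs0P := open_nbhs_nbhs (conj oU Ux).
    by apply: filterS => y; rewrite addrC.
  have /eqaddoP/(_ _ (divr_gt0 e0 N0)) := diff_locally dfv.
  by apply: filterS => y; rewrite /= !fctE opprD addrA.
move=> /nbhs_norm0P[d /= d0 near_d]; exists (d / N); first exact: divr_gt0.
move=> h /andP[h0]; rewrite ltr_pdivlMr// => hd.
have small (t : R) (c : R) : 0 <= t <= h -> 0 <= c <= h -> `|t *: v + c *: w| < d.
  move=> /andP[t0 th] /andP[c0 ch]; apply: le_lt_trans hd.
  rewrite (le_trans (ler_normD _ _))// !normrZ !ger0_norm//.
  rewrite /N mulrDr mulr1 mulrDr -[leLHS]addr0 lerD//; last exact: ltW.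
  rewrite lerD// ?ler_wpM2r//.
  by rewrite mulr_natl mulr2n mulrDr -[leLHS]addr0 lerD// ?ler_wpM2r ?mulr_ge0// ltW.
have D1 (t : R) : 0 <= t <= h -> U (t *: v + h *: w + x) /\ U (t *: v + x).
  move=> th; have hh : 0 <= h <= h by rewrite lexx ltW.
  have z0 : 0 <= (0 : R) <= h by rewrite lexx ltW.
  split; first by have [] := near_d _ (small t h th hh).
  by have [] := near_d _ (small t 0 th z0); rewrite scale0r addr0.
pose F (t : R) : R := f (t *: v + (h *: w + x)) - f (t *: v + x).
pose dF (t : R) : R := fv (t *: v + (h *: w + x)) - fv (t *: v + x).
have Fd t : 0 <= t <= h -> is_derive t 1 F (dF t).
  move=> th; have [U1 U2] := D1 t th.
  rewrite /F /dF; apply: is_deriveB; apply: is_derive_line; apply: dU => //.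
  by rewrite addrA.
have [t th||c] := @MVT R F dF 0 h h0.
- by apply: Fd; move: th; rewrite in_itv/= => /andP[t0 t1]; rewrite !ltW.
- apply: derivable_within_continuous => t; rewrite in_itv/= => th.
  by have [] := Fd t th.
rewrite in_itv/= => /andP[c0 ch]; rewrite subr0 => Fh.
have cc : 0 <= c <= h by rewrite !ltW.
have hh : 0 <= h <= h by rewrite lexx ltW.
have z0 : 0 <= (0 : R) <= h by rewrite lexx ltW.
have [_ b1] := near_d _ (small c h cc hh).
have [_ b2] := near_d _ (small c 0 cc z0).
move: b1 b2; rewrite scale0r addr0 linearD linearZ /= linearZ /= => b1 b2.
have -> : f (h *: v + h *: w + x) - f (h *: v + x) - f (h *: w + x) + f x = F h - F 0.
  by rewrite /F !scale0r !add0r addrA; ring.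
rewrite Fh /dF expr2 -mulrA [_ * h]mulrC -mulrBr normrM gtr0_norm// mulrCA.
rewrite ler_pM2l// addrA.
have -> : fv (c *: v + h *: w + x) - fv (c *: v + x) - h * 'd fv x w =
   (fv (c *: v + h *: w + x) - fv x - (c * 'd fv x v + h * 'd fv x w))
   - (fv (c *: v + x) - fv x - c * 'd fv x v) by ring.
rewrite (le_trans (ler_normB _ _))// (le_trans (lerD b1 b2))//.
rewrite -mulrDr -mulrA ler_pM2l// ler_pdivrMl//.
rewrite normrZ (gtr0_norm c0) (le_trans (lerD (ler_normD _ _) (lexx _)))//.
rewrite !normrZ (gtr0_norm c0) (gtr0_norm h0) /N.
have := normr_ge0 v; have := normr_ge0 w; nra.
Qed.

(** Used in both orders with tolerance [e / 2] and a common [h], the estimate brings both mixed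
    derivatives, times [h ^+ 2], close to the same second difference. *)
Lemma schwarz (f fv fw : V -> R) (U : set V) (x v w : V) :
  open U -> U x -> (forall y, U y -> is_derive y v f (fv y)) ->
  (forall y, U y -> is_derive y w f (fw y)) ->
  differentiable fv x -> differentiable fw x ->
  'D_w fv x = 'D_v fw x.
Proof.
move=> oU Ux dv dw dfv dfw; rewrite !deriveE//.
apply/eqP; rewrite -subr_eq0 -normr_le0; apply/ler_addgt0Pr => e e0; rewrite add0r.
have e2 : 0 < e / 2 by rewrite divr_gt0.
have [d1 d10 h1] := second_difference w oU Ux dv dfv e2.
have [d2 d20 h2] := second_difference v oU Ux dw dfw e2.
pose h := Num.min d1 d2 / 2.
have m0 : 0 < Num.min d1 d2 by rewrite lt_min d10.
have h0 : 0 < h by rewrite divr_gt0.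
have hm : h < Num.min d1 d2 by rewrite /h; lra.
have hd1 : 0 < h < d1 by rewrite h0 (lt_le_trans hm)// ge_min lexx.
have {}h1 := h1 h hd1.
have hd2 : 0 < h < d2 by rewrite h0 (lt_le_trans hm)// ge_min lexx orbT.
have {}h2 := h2 h hd2.
have hh : 0 < h ^+ 2 by rewrite exprn_gt0.
rewrite -(ler_pM2r hh) -[X in `|_| * X](gtr0_norm hh) -normrM.
rewrite [h *: w + h *: v]addrC in h2.
have := ler_normB (f (h *: v + h *: w + x) - f (h *: w + x) - f (h *: v + x) + f x
      - h ^+ 2 * 'd fw x v) (f (h *: v + h *: w + x) - f (h *: v + x) - f (h *: w + x) + f x
      - h ^+ 2 * 'd fv x w).
move: h1 h2; set A := `| _ |; set B := `| _ | => h1 h2 h3.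
have -> : ('d fv x w - 'd fw x v) * h ^+ 2 =
   (f (h *: v + h *: w + x) - f (h *: w + x) - f (h *: v + x) + f x
      - h ^+ 2 * 'd fw x v) - (f (h *: v + h *: w + x) - f (h *: v + x) - f (h *: w + x) + f x
      - h ^+ 2 * 'd fv x w) by ring.
lra.
Qed.

End SecondDerivative.

(** * Calculus of matrix-valued maps *)

Section MatrixCalculus.
Variables (R : realType) (V : normedModType R).

Lemma is_derive_mxP m n (F : V -> 'M[R]_(m, n)) x v dF :
  is_derive x v F dF <-> forall i j, is_derive x v (fun y => F y i j) (dF i j).
Proof.
split=> [[d e] i j|h].
  split; first exact: (derivable_mxP _ _ _).1 d i j.
  by rewrite -e (derive_mx d) mxE.
have d : derivable F x v by apply/derivable_mxP => i j; case: (h i j).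
split=> //; rewrite derive_mx//; apply/matrixP => i j; rewrite mxE.
by case: (h i j).
Qed.

Lemma is_derive_mulmx m n p (A : V -> 'M[R]_(m, n)) (B : V -> 'M[R]_(n, p)) x v dA dB :
  is_derive x v A dA -> is_derive x v B dB ->
  is_derive x v (fun y => A y *m B y) (dA *m B x + A x *m dB).
Proof.
move=> /is_derive_mxP hA /is_derive_mxP hB; apply/is_derive_mxP => i j.
have -> : (fun y => (A y *m B y) i j) =
    \sum_(k < n) ((fun y => A y i k) * (fun y => B y k j)).
  by apply/funext => y; rewrite mxE fct_sumE.
have dAB k : is_derive x v ((fun y => A y i k) * (fun y => B y k j))
    (A x i k *: dB k j + B x k j *: dA i k) by exact: is_deriveM.
apply: is_derive_eq.
rewrite !mxE -big_split /=; apply: eq_bigr => k _.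
by rewrite /GRing.scale /= addrC; congr (_ + _); rewrite mulrC.
Qed.

Lemma is_derive_trmx m n (A : V -> 'M[R]_(m, n)) x v dA :
  is_derive x v A dA -> is_derive x v (fun y => (A y)^T) dA^T.
Proof.
move=> /is_derive_mxP h; apply/is_derive_mxP => i j; rewrite mxE.
by under eq_fun do rewrite mxE.
Qed.

Lemma is_derive_scalemx m n (k : V -> R) (A : V -> 'M[R]_(m, n)) x v dk dA :
  is_derive x v k dk -> is_derive x v A dA ->
  is_derive x v (fun y => k y *: A y) (dk *: A x + k x *: dA).
Proof.
move=> hk /is_derive_mxP h; apply/is_derive_mxP => i j.
have -> : (fun y => (k y *: A y) i j) = k * (fun y => A y i j).
  by apply/funext => y; rewrite mxE.
apply: is_derive_eq.
by rewrite !mxE /GRing.scale /=; ring.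
Qed.

(** The tool for differentiating an identity that holds on an open set: each side is derived
    separately and the results agree. *)
Lemma is_derive_unique_on (W : normedModType R) (U : set V) (f g : V -> W) x v df dg :
  open U -> U x -> (forall y, U y -> f y = g y) ->
  is_derive x v f df -> is_derive x v g dg -> df = dg.
Proof.
move=> oU Ux fg [_ <-] [_ <-]; apply: near_eq_derive.
by apply: filterS (open_nbhs_nbhs (conj oU Ux)).
Qed.

Lemma differentiable_entry m n (F : V -> 'M[R]_(m, n)) x i j :
  differentiable F x -> differentiable (fun y => F y i j) x.
Proof.
move=> dF; apply: (@differentiable_comp _ _ _ _ F (fun A : 'M[R]_(m, n) => A i j)) => //.
exact: differentiable_coord.
Qed.

Lemma differentiable_is_derive (W : normedModType R) (f : V -> W) x v :
  differentiable f x -> is_derive x v f ('D_v f x).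
Proof. by move=> df; apply: derivableP; exact: diff_derivable. Qed.

Lemma derive_linear (W : normedModType R) (f : V -> W) x k v w :
  differentiable f x -> 'D_(k *: v + w) f x = k *: 'D_v f x + 'D_w f x.
Proof. by move=> df; rewrite !deriveE// linearP. Qed.

Lemma smooth_differentiable (W : normedModType R) (U : set V) (f : V -> W) x :
  smooth_on U f -> U x -> differentiable f x.
Proof. by move=> /(_ 1%N)[h _] /h. Qed.

Lemma smooth_derive (W : normedModType R) (U : set V) (f : V -> W) v :
  smooth_on U f -> smooth_on U ('D_v f).
Proof. by move=> h k; have [_] := h k.+1; apply. Qed.

Lemma smooth_cst (W : normedModType R) (U : set V) (a : W) :
  smooth_on U (cst a : V -> W).
Proof.
move=> k; elim: k a => [|k IH] a /=; first by move=> x _; exact: cst_continuous.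
split=> [x _|v]; first exact: differentiable_cst.
have -> : 'D_v (cst a : V -> W) = cst 0; last exact: IH.
by apply/funext => x; exact: derive_cst.
Qed.

Lemma smooth_is_derive (W : normedModType R) (U : set V) (f : V -> W) x v :
  smooth_on U f -> U x -> is_derive x v f ('D_v f x).
Proof. by move=> sf Ux; apply: differentiable_is_derive; exact: smooth_differentiable Ux. Qed.

Lemma mx_schwarz m n (F : V -> 'M[R]_(m, n)) (U : set V) x v w :
  open U -> U x -> smooth_on U F -> 'D_w ('D_v F) x = 'D_v ('D_w F) x.
Proof.
move=> oU Ux sF; have dD a : differentiable ('D_a F) x.
  exact: smooth_differentiable (smooth_derive a sF) Ux.
have dD' a b : derivable ('D_a F) x b by exact: diff_derivable.
rewrite (derive_mx (dD' v w)) (derive_mx (dD' w v)).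
apply/matrixP => i j; rewrite [LHS]mxE [RHS]mxE.
have dF a y : U y -> is_derive y a (fun z => F z i j) ('D_a F y i j).
  by move=> Uy; apply: (is_derive_mxP _ _ _ _).1; exact: smooth_is_derive Uy.
apply: (@schwarz _ _ (fun z => F z i j) (fun z => 'D_v F z i j) (fun z => 'D_w F z i j)
  U x v w oU Ux (dF v) (dF w)).
  exact: (differentiable_entry i j (dD v)).
exact: (differentiable_entry i j (dD w)).
Qed.

End MatrixCalculus.

(** [jacobi_mx] and [nabla_frame] apply [lin1_mx] to bare functions; a separate proof of linearity
    is packed here. *)
Lemma linear_lin1_mx (R : realType) m n (f : 'rV[R]_m -> 'rV[R]_n) v :
  (forall k x y, f (k *: x + y) = k *: f x + f y) -> v *m lin1_mx f = f v.
Proof.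
move=> h; pose f' : {linear 'rV_m -> 'rV_n} := HB.pack f (GRing.isLinear.Build _ _ _ _ f h).
exact: (mul_rV_lin1 f' v).
Qed.

(** * Covariant derivatives in a chart *)

Section BilinCalculus.
Variables (R : realType) (m : nat).
Implicit Types (G : 'rV[R]_m -> 'M[R]_m) (v w : 'rV[R]_m -> 'rV[R]_m).

Lemma is_derive_bilin G v w x d dG dv dw :
  is_derive x d G dG -> is_derive x d v dv -> is_derive x d w dw ->
  is_derive x d (fun y => bilin (G y) (v y) (w y))
    (bilin dG (v x) (w x) + bilin (G x) dv (w x) + bilin (G x) (v x) dw).
Proof.
move=> hG hv hw.
have := is_derive_mulmx (is_derive_mulmx hv hG) (is_derive_trmx hw).
move/is_derive_mxP => /(_ 0 0) h; apply: (is_derive_eq h).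
rewrite mulmxDl /bilin.
move: (dv *m G x *m (w x)^T) (v x *m dG *m (w x)^T) (v x *m G x *m dw^T) => A B C.
by rewrite !mxE [X in X + _]addrC.
Qed.

Lemma is_derive_bilinl G v (w : 'rV[R]_m) x d dG dv :
  is_derive x d G dG -> is_derive x d v dv ->
  is_derive x d (fun y => bilin (G y) (v y) w) (bilin dG (v x) w + bilin (G x) dv w).
Proof.
move=> hG hv; apply: (is_derive_eq (is_derive_bilin hG hv (is_derive_cst w x d))).
by rewrite bilin0r addr0.
Qed.

Lemma is_derive_bilinr G (v : 'rV[R]_m) w x d dG dw :
  is_derive x d G dG -> is_derive x d w dw ->
  is_derive x d (fun y => bilin (G y) v (w y)) (bilin dG v (w x) + bilin (G x) v dw).
Proof.
move=> hG hw; apply: (is_derive_eq (is_derive_bilin hG (is_derive_cst v x d) hw)).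
by rewrite bilin0l addr0.
Qed.

Lemma is_derive_bilin_cst G (v w : 'rV[R]_m) x d dG :
  is_derive x d G dG -> is_derive x d (fun y => bilin (G y) v w) (bilin dG v w).
Proof.
move=> hG; apply: (is_derive_eq (is_derive_bilinl w hG (is_derive_cst v x d))).
by rewrite bilin0l addr0.
Qed.

Lemma is_derive_mul_entry (F : 'rV[R]_m -> 'cV[R]_m) (b : 'rV[R]_m) x d dF :
  is_derive x d F dF ->
  is_derive x d (fun y => (b *m F y) 0 0) ((b *m dF) 0 0).
Proof.
move=> hF; have := is_derive_mulmx (is_derive_cst b x d) hF.
by rewrite mul0mx add0r => /is_derive_mxP /(_ 0 0).
Qed.

Lemma is_derive_mulcl n (F : 'rV[R]_m -> 'M[R]_(m, n)) (b : 'rV[R]_m) x d dF :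
  is_derive x d F dF -> is_derive x d (fun y => b *m F y) (b *m dF).
Proof.
by move=> hF; have := is_derive_mulmx (is_derive_cst b x d) hF; rewrite mul0mx add0r.
Qed.

End BilinCalculus.

(** * The S-structure read in one chart *)

Section Chart.
Variables (R : realType) (n s : nat).
Local Notation m := (2 * n + s)%N.
Local Notation E := 'rV[R]_m.
Variables (U : set E) (G phi : E -> 'M[R]_m) (xi : 'I_s -> E -> E).
Variables (eta : 'I_s -> E -> 'cV[R]_m) (Gam : 'I_m -> E -> 'M[R]_m).
Local Notation eps a y := (bilin (G y) (xi a y) (xi a y)).
Local Notation xib y := (\sum_a xi a y).
Implicit Types (x y z v w a b c : E) (k : R).

Hypothesis oU : open U.
Hypothesis sG : smooth_on U G.
Hypothesis sphi : smooth_on U phi.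
Hypothesis sxi : forall i, smooth_on U (xi i).
Hypothesis seta : forall i, smooth_on U (eta i).
Hypothesis sGam : forall i, smooth_on U (Gam i).
Hypothesis Gsym : forall y, U y -> (G y)^T = G y.
Hypothesis Gunit : forall y, U y -> G y \in unitmx.
Hypothesis phi_rk : forall y, U y -> \rank (phi y) = (2 * n)%N.
Hypothesis phi2 : forall y, U y -> forall v,
  v *m phi y *m phi y = - v + \sum_i (v *m eta i y) 0 0 *: xi i y.
Hypothesis eta_xi1 : forall y, U y -> forall i j,
  (xi j y *m eta i y) 0 0 = (i == j)%:R.
Hypothesis eps1 : forall y, U y -> forall i, eps i y = 1 \/ eps i y = -1.
Hypothesis compat : forall y, U y -> forall v w,
  bilin (G y) (v *m phi y) (w *m phi y) =
  bilin (G y) v w - \sum_i eps i y * (v *m eta i y) 0 0 * (w *m eta i y) 0 0.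
Hypothesis normal_cst : forall a b y, U y ->
  nijenhuis phi (cst a) (cst b) y
  + \sum_i (2 * dform (eta i) (cst a) (cst b) y) *: xi i y = 0.
Hypothesis contact_cst : forall i a b y, U y ->
  dform (eta i) (cst a) (cst b) y = innerT G (cst a) (applyT phi (cst b)) y.
Hypothesis torsion_cst : forall a b y, U y ->
  cov Gam (cst a) (cst b) y - cov Gam (cst b) (cst a) y = lie (cst a) (cst b) y.
Hypothesis metric_cst : forall a b c y, U y ->
  'D_a (innerT G (cst b) (cst c)) y =
  innerT G (cov Gam (cst a) (cst b)) (cst c) y
  + innerT G (cst b) (cov Gam (cst a) (cst c)) y.

Definition christoffel_along a y : 'M[R]_m := \sum_i a 0 i *: Gam i y.
Local Notation Gm := christoffel_along.

Lemma christoffel_alongP k a b y : Gm (k *: a + b) y = k *: Gm a y + Gm b y.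
Proof.
rewrite /christoffel_along scaler_sumr -big_split /=; apply: eq_bigr => i _.
by rewrite !mxE scalerDl scalerA.
Qed.

Lemma covE a (Y : E -> E) y : cov Gam (cst a) Y y = 'D_a Y y + Y y *m Gm a y.
Proof.
rewrite /cov /christoffel_along mulmx_sumr; congr (_ + _); apply: eq_bigr => i _.
by rewrite -scalemxAr.
Qed.

Lemma cov_cst a b y : cov Gam (cst a) (cst b) y = b *m Gm a y.
Proof. by rewrite covE derive_cst add0r. Qed.

Lemma lie_cst a b y : lie (cst a) (cst b) y = 0.
Proof. by rewrite /lie !derive_cst subrr. Qed.

Lemma christoffel_along_diff a y : U y -> differentiable (Gm a) y.
Proof.
move=> Uy; have -> : Gm a = \sum_i (a 0 i *: Gam i).
  by apply/funext => z; rewrite /christoffel_along fct_sumE.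
apply: differentiable_sum => i; apply: differentiableZ.
exact: smooth_differentiable Uy.
Qed.

Lemma is_derive_christoffel a y d : U y -> is_derive y d (Gm a) ('D_d (Gm a) y).
Proof. by move=> Uy; apply: differentiable_is_derive; exact: christoffel_along_diff. Qed.

Lemma torsion_free a b y : U y -> b *m Gm a y = a *m Gm b y.
Proof.
move=> Uy; have := torsion_cst a b Uy; rewrite !cov_cst lie_cst => /eqP.
by rewrite subr_eq0 => /eqP.
Qed.

Lemma bilin_metric d a b y : U y ->
  bilin ('D_d G y) a b = bilin (G y) (a *m Gm d y) b + bilin (G y) a (b *m Gm d y).
Proof.
move=> Uy; have := metric_cst d a b Uy; rewrite /innerT !cov_cst => <-.
by case: (is_derive_bilin_cst a b (smooth_is_derive d sG Uy)) => _ ->.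
Qed.

(** On a constant field [b] this is [nabla_a (phi b) - phi (nabla_a b)], with products ordered by
    the right action. *)
Definition nabla_endo a y : 'M[R]_m :=
  'D_a phi y + phi y *m Gm a y - Gm a y *m phi y.

Definition nabla_frame i y : 'M[R]_m :=
  lin1_mx (fun a => 'D_a (xi i) y + xi i y *m Gm a y).

(** The commutator of [nabla_a] and [nabla_b] on constant fields, whose Lie bracket vanishes. *)
Definition riemann a b y : 'M[R]_m :=
  'D_a (Gm b) y - 'D_b (Gm a) y + Gm b y *m Gm a y - Gm a y *m Gm b y.

Lemma nabla_endoE a b y :
  b *m nabla_endo a y =
  b *m 'D_a phi y + b *m phi y *m Gm a y - b *m Gm a y *m phi y.
Proof. by rewrite /nabla_endo mulmxBr mulmxDr !mulmxA. Qed.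

Lemma nabla_endoP k a b y : U y ->
  nabla_endo (k *: a + b) y = k *: nabla_endo a y + nabla_endo b y.
Proof.
move=> Uy; rewrite /nabla_endo (derive_linear _ _ _ (smooth_differentiable sphi Uy)).
rewrite christoffel_alongP mulmxDr mulmxDl -scalemxAr -scalemxAl.
move: ('D_a phi y) ('D_b phi y) (phi y *m Gm a y) (phi y *m Gm b y) => A B C D.
move: (Gm a y *m _) (Gm b y *m _) => A' B'.
by apply/matrixP => i j; rewrite !mxE; ring.
Qed.

Lemma nabla_frameE i a y : U y ->
  a *m nabla_frame i y = 'D_a (xi i) y + xi i y *m Gm a y.
Proof.
move=> Uy; rewrite linear_lin1_mx// => k b c.
rewrite (derive_linear _ _ _ (smooth_differentiable (sxi i) Uy)).
rewrite christoffel_alongP mulmxDr -scalemxAr.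
move: ('D_b (xi i) y) ('D_c (xi i) y) => u w.
by rewrite scalerDr addrACA.
Qed.

Lemma is_derive_phi d y : U y -> is_derive y d phi ('D_d phi y).
Proof. exact: smooth_is_derive. Qed.

Lemma is_derive_xi i d y : U y -> is_derive y d (xi i) ('D_d (xi i) y).
Proof. exact: smooth_is_derive. Qed.

Lemma is_derive_metric d y : U y -> is_derive y d G ('D_d G y).
Proof. exact: smooth_is_derive. Qed.

Lemma dform_cst i a b y : U y ->
  dform (eta i) (cst a) (cst b) y =
  2^-1 * ((b *m 'D_a (eta i) y) 0 0 - (a *m 'D_b (eta i) y) 0 0).
Proof.
move=> Uy; rewrite /dform /pairing lie_cst mul0mx.
have h d v : is_derive y d (fun z => (v *m eta i z) 0 0) ((v *m 'D_d (eta i) y) 0 0).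
  by apply: is_derive_mul_entry; exact: smooth_is_derive Uy.
case: (h a b) => _ ->; case: (h b a) => _ ->.
by rewrite [X in _ - X]mxE subr0.
Qed.

Lemma contactE i a b y : U y ->
  bilin (G y) a (b *m phi y) =
  2^-1 * ((b *m 'D_a (eta i) y) 0 0 - (a *m 'D_b (eta i) y) 0 0).
Proof. by move=> Uy; rewrite -dform_cst// contact_cst. Qed.

Lemma eps_sq i y : U y -> eps i y * eps i y = 1.
Proof. by move=> /eps1 /(_ i) [] ->; rewrite ?mulr1 ?mulrNN ?mul1r. Qed.

Lemma derive_frame_metric i j d y : U y ->
  is_derive y d (fun z => bilin (G z) (xi i z) (xi j z))
    (bilin (G y) (d *m nabla_frame i y) (xi j y)
     + bilin (G y) (xi i y) (d *m nabla_frame j y)).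
Proof.
move=> Uy; have h := is_derive_bilin (is_derive_metric d Uy)
  (is_derive_xi i d Uy) (is_derive_xi j d Uy).
apply: (is_derive_eq h); rewrite bilin_metric// !nabla_frameE// bilinDl bilinDr.
by ring.
Qed.

(** Differentiating [eps_sq] shows that [eps] times this sum is zero, and [eps] is 1 or -1. *)
Lemma derive_eps i d y : U y ->
  bilin (G y) (d *m nabla_frame i y) (xi i y)
  + bilin (G y) (xi i y) (d *m nabla_frame i y) = 0.
Proof.
move=> Uy; have h := derive_frame_metric i i d Uy.
have h2 := is_deriveM h h.
have := is_derive_unique_on oU Uy (fun z Uz => eps_sq i Uz) h2 (is_derive_cst (1 : R) y d).
rewrite /GRing.scale /=; case: (eps1 Uy i) => -> ; lra.
Qed.

Lemma is_derive_eps i d y : U y -> is_derive y d (fun z => eps i z) 0.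
Proof.
by move=> Uy; apply: (is_derive_eq (derive_frame_metric i i d Uy)); exact: derive_eps.
Qed.

Lemma frame_orth i j y : U y ->
  bilin (G y) (xi i y) (xi j y) = (i == j)%:R * eps i y.
Proof.
move=> Uy.
exact: (xi_orth (phi_rk Uy) (phi2 Uy) (eta_xi1 Uy) (eps1 Uy) (compat Uy)).
Qed.

Lemma phi_skew_at v w y : U y ->
  bilin (G y) (v *m phi y) w = - bilin (G y) v (w *m phi y).
Proof. by move=> Uy; exact: (phi_skew (phi_rk Uy) (phi2 Uy) (eta_xi1 Uy) (compat Uy)). Qed.

Section AtPoint.
Variable y : E.
Hypothesis Uy : U y.
Local Notation g := (bilin (G y)).
Local Notation P := (fun a => nabla_endo a y).
Local Notation Q := (fun i => nabla_frame i y).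

Lemma nabla_endo_skew d a b : g (a *m P d) b = - g a (b *m P d).
Proof.
have dL := is_derive_bilinl b (is_derive_metric d Uy)
  (is_derive_mulcl a (is_derive_phi d Uy)).
have dR := is_deriveN (is_derive_bilinr a (is_derive_metric d Uy)
  (is_derive_mulcl b (is_derive_phi d Uy))).
have := is_derive_unique_on oU Uy (fun z Uz => phi_skew_at a b Uz) dL dR.
rewrite !bilin_metric//.
rewrite !nabla_endoE !(bilinDl, bilinDr, bilinNl, bilinNr).
have h1 := phi_skew_at a (b *m Gm d y) Uy.
have h2 := phi_skew_at (a *m Gm d y) b Uy.
lra.
Qed.

(** This is [d(d eta) = 0] for one of the forms, hence the index [i0]. In the cyclic sum the second
    derivatives of [eta i0] cancel by Schwarz, the Christoffel terms by torsion-freeness and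
    skewness of [phi]. *)
Lemma nabla_endo_closed (i0 : 'I_s) a b c :
  g (b *m P a) c + g (c *m P b) a + g (a *m P c) b = 0.
Proof.
have [T T_sym D] : exists2 T : E -> E -> E -> R,
    forall d u v, T d u v = T u d v &
    forall d u v,
    g (u *m Gm d y) (v *m phi y) + g u (v *m P d) + g u (v *m Gm d y *m phi y) =
    2^-1 * (T d u v - T d v u).
  exists (fun d u v => (v *m 'D_d ('D_u (eta i0)) y) 0 0) => d u v.
    by rewrite (mx_schwarz d u oU Uy (seta i0)).
  have dL := is_derive_bilinr u (is_derive_metric d Uy)
    (is_derive_mulcl v (is_derive_phi d Uy)).
  have dE u' v' := is_derive_mul_entry v'
    (smooth_is_derive d (smooth_derive u' (seta i0)) Uy).
  have dR := is_deriveZ 2^-1 (is_deriveB (dE u v) (dE v u)).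
  apply: etrans (is_derive_unique_on oU Uy (fun z Uz => contactE i0 u v Uz) dL dR).
  rewrite bilin_metric// nabla_endoE !(bilinDr, bilinNr).
  move: ('D_d phi y) => A; ring.
have := D a b c; have := D b c a; have := D c a b.
rewrite (T_sym b a) (T_sym c a) (T_sym c b) !(nabla_endo_skew _ _ _).
have k u v : g u (v *m phi y) = - g v (u *m phi y).
  by rewrite (bilinC u _ (Gsym Uy)) phi_skew_at.
rewrite (torsion_free a b Uy) (torsion_free c a Uy) (torsion_free b c Uy).
rewrite (k b) (k c (a *m _)) (k a).
move: (nabla_endo a y) (nabla_endo b y) (nabla_endo c y) => Pa Pb Pc.
move: (a *m Gm b y) (c *m Gm a y) (b *m Gm c y) => u v w.
lra.
Qed.

Lemma nabla_endo_xi i d : xi i y *m P d = - (d *m Q i *m phi y).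
Proof.
have xiphi z : U z -> xi i z *m phi z = 0.
  by move=> Uz; exact: (xi_phi (phi_rk Uz) (phi2 Uz)).
have := is_derive_unique_on oU Uy xiphi
  (is_derive_mulmx (is_derive_xi i d Uy) (is_derive_phi d Uy))
  (is_derive_cst (0 : E) y d).
rewrite nabla_frameE// nabla_endoE mulmxDl xiphi// mul0mx addr0.
move: ('D_d (xi i) y) ('D_d phi y) => A B /eqP.
by rewrite addrC addr_eq0 => /eqP ->; rewrite opprD.
Qed.

Lemma nabla_endo_phi3 d b :
  b *m phi y *m phi y *m P d + b *m phi y *m P d *m phi y
  + b *m P d *m phi y *m phi y = - (b *m P d).
Proof.
have phi3_at z v : U z -> v *m phi z *m phi z *m phi z = - (v *m phi z).
  by move=> Uz; exact: (phi3 (phi_rk Uz) (phi2 Uz)).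
have d1 := is_derive_mulcl b (is_derive_phi d Uy).
have d2 := is_derive_mulmx d1 (is_derive_phi d Uy).
have d3 := is_derive_mulmx d2 (is_derive_phi d Uy).
have := is_derive_unique_on oU Uy (fun z Uz => phi3_at z b Uz) d3 (is_deriveN d1).
rewrite !nabla_endoE !mulmxBl !mulmxDl !phi3_at//.
move: ('D_d phi y) => A; rewrite mulNmx.
move: (b *m phi y *m phi y *m A) (b *m phi y *m A *m phi y) => v1 v2.
move: (b *m A *m phi y *m phi y) (b *m A) => v3 v4.
move: (b *m phi y *m phi y *m Gm d y *m phi y) => v5.
move: (b *m phi y *m phi y *m Gm d y) => v5'.
move: (b *m phi y *m Gm d y *m phi y *m phi y) => v6.
move: (b *m phi y *m Gm d y *m phi y) (b *m phi y *m Gm d y) (b *m Gm d y *m phi y) => v7 v8 v9.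
move=> /rowP h; apply/rowP => j; have := h j; rewrite !mxE; lra.
Qed.

(** [eta i] is [eps] times [g (., xi i)] and [eps] has zero derivative, so [d eta] is the skew part
    of [Q i] up to sign and scale; the Christoffel terms cancel by symmetry. *)
Lemma nabla_frame_contact i a b :
  g (a *m Q i) b - g a (b *m Q i) = - (2 * eps i y * g (a *m phi y) b).
Proof.
have etaE z v : U z -> (v *m eta i z) 0 0 = eps i z * bilin (G z) v (xi i z).
  by move=> Uz; exact: (eta_metric (phi_rk Uz) (phi2 Uz) (eta_xi1 Uz) (eps1 Uz) (compat Uz)).
have [T D] : exists2 T : E -> E -> R,
    forall d v, T d v = eps i y * (g (v *m Gm d y) (xi i y) + g v (d *m Q i)) &
    2^-1 * (T a b - T b a) = g a (b *m phi y).
  exists (fun d v => (v *m 'D_d (eta i) y) 0 0); last exact: (esym (contactE i a b Uy)).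
  move=> d v; have dL := is_derive_mul_entry v (smooth_is_derive d (seta i) Uy).
  have dR := is_deriveM (is_derive_eps i d Uy)
    (is_derive_bilinr v (is_derive_metric d Uy) (is_derive_xi i d Uy)).
  rewrite (is_derive_unique_on oU Uy (fun z Uz => etaE z v Uz) dL dR).
  rewrite scaler0 addr0 bilin_metric// nabla_frameE//.
  rewrite bilinDr -addrA [g v _ + _]addrC; exact: erefl.
rewrite !D (torsion_free a b Uy) phi_skew_at// (bilinC b (a *m Q i) (Gsym Uy)).
by case: (eps1 Uy i) => ->; lra.
Qed.

Lemma nabla_frame_orth i j d :
  g (d *m Q i) (xi j y) + g (xi i y) (d *m Q j) = 0.
Proof.
have dR := is_deriveZ (i == j)%:R (is_derive_eps i d Uy).
have := is_derive_unique_on oU Uy (fun z Uz => frame_orth i j Uz)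
  (derive_frame_metric i j d Uy) dR.
by rewrite scaler0.
Qed.

Lemma nijenhuis_cst a b :
  nijenhuis phi (cst a) (cst b) y =
  b *m 'D_(a *m phi y) phi y - a *m 'D_(b *m phi y) phi y
  + a *m 'D_b phi y *m phi y - b *m 'D_a phi y *m phi y.
Proof.
have D d v : 'D_d (applyT phi (cst v)) y = v *m 'D_d phi y.
  by case: (is_derive_mulcl v (is_derive_phi d Uy)).
have l1 : lie (applyT phi (cst a)) (applyT phi (cst b)) y =
    b *m 'D_(a *m phi y) phi y - a *m 'D_(b *m phi y) phi y by rewrite /lie !D.
have l2 : lie (applyT phi (cst a)) (cst b) y = - (a *m 'D_b phi y).
  by rewrite /lie D derive_cst sub0r.
have l3 : lie (cst a) (applyT phi (cst b)) y = b *m 'D_a phi y.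
  by rewrite /lie D derive_cst subr0.
have -> : nijenhuis phi (cst a) (cst b) y =
    lie (cst a) (cst b) y *m phi y *m phi y
    + lie (applyT phi (cst a)) (applyT phi (cst b)) y
    - lie (applyT phi (cst a)) (cst b) y *m phi y
    - lie (cst a) (applyT phi (cst b)) y *m phi y by [].
by rewrite lie_cst l1 l2 l3 !mul0mx add0r mulNmx opprK.
Qed.

(** Covariant derivatives may replace partial ones in the Nijenhuis tensor: torsion-freeness cancels
    the Christoffel terms. *)
Lemma nabla_endo_normal a b :
  b *m P (a *m phi y) - a *m P (b *m phi y) + a *m P b *m phi y - b *m P a *m phi y
  + (2 * g a (b *m phi y)) *: xib y = 0.
Proof.
have := normal_cst a b Uy; rewrite nijenhuis_cst.
have -> : \sum_i (2 * dform (eta i) (cst a) (cst b) y) *: xi i y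
    = (2 * g a (b *m phi y)) *: xib y.
  by rewrite scaler_sumr; apply: eq_bigr => i _; rewrite contact_cst.
move=> h; rewrite -[RHS]h; congr (_ + _); rewrite !nabla_endoE.
rewrite (torsion_free (a *m phi y) (b *m phi y) Uy).
rewrite (torsion_free (a *m phi y) b Uy) (torsion_free (b *m phi y) a Uy).
rewrite (torsion_free a b Uy) !mulmxBl !mulmxDl.
move: ('D_(a *m phi y) phi y) ('D_(b *m phi y) phi y) ('D_a phi y) ('D_b phi y).
move=> A B C D.
move: (b *m A) (a *m B) (a *m D *m phi y) (b *m C *m phi y) => v1 v2 v3 v4.
move: (a *m phi y *m Gm (b *m phi y) y) => v5.
move: (a *m phi y *m Gm b y *m phi y) (b *m phi y *m Gm a y *m phi y) => v6 v7.
move: (a *m Gm b y *m phi y *m phi y) => v8.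
by apply/rowP => j; rewrite !mxE; ring.
Qed.

Lemma nabla_xi_at i a : a *m Q i = - eps i y *: (a *m phi y).
Proof.
apply: (nabla_xi (Gsym Uy) (Gunit Uy) (phi_rk Uy) (phi2 Uy) (eta_xi1 Uy) (eps1 Uy)
  (compat Uy) (Q := Q) (P := P)).
- by move=> k u v; exact: nabla_endoP.
- by move=> u v w; exact: nabla_endo_skew.
- by move=> u v w; exact: (nabla_endo_closed i).
- by move=> *; exact: nabla_endo_xi.
- by move=> *; exact: nabla_frame_contact.
- by move=> *; exact: nabla_frame_orth.
- by move=> *; exact: nabla_endo_normal.
Qed.

Lemma nabla_phi_at (i0 : 'I_s) d a :
  a *m P d = g (d *m phi y) (a *m phi y) *: xib y
    + g a (xib y) *: (d *m phi y *m phi y).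
Proof.
apply: (nabla_phi (Gsym Uy) (Gunit Uy) (phi_rk Uy) (phi2 Uy) (eta_xi1 Uy) (eps1 Uy)
  (compat Uy) (Q := Q) (P := P)).
- by move=> k u v; exact: nabla_endoP.
- by move=> u v w; exact: nabla_endo_skew.
- by move=> u v w; exact: (nabla_endo_closed i0).
- by move=> *; exact: nabla_endo_xi.
- by move=> *; exact: nabla_endo_phi3.
- by move=> *; exact: nabla_frame_contact.
- by move=> *; exact: nabla_frame_orth.
- by move=> *; exact: nabla_endo_normal.
Qed.

End AtPoint.

(** * Curvature identities at a point of the chart *)

Section RiemannAtPoint.
Variable y : E.
Hypothesis Uy : U y.
Local Notation g := (bilin (G y)).

Lemma riemann_alt a b : riemann a b y = - riemann b a y.
Proof.
rewrite /riemann; move: ('D_a (Gm b) y) ('D_b (Gm a) y) => A B.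
move: (Gm b y *m _) (Gm a y *m _) => C D.
by apply/matrixP => i j; rewrite !mxE; ring.
Qed.

Lemma riemannP k a b c : riemann a (k *: b + c) y = k *: riemann a b y + riemann a c y.
Proof.
have d1 := is_derive_christoffel (k *: b + c) a Uy.
have d2 := is_deriveD (is_deriveZ k (is_derive_christoffel b a Uy))
  (is_derive_christoffel c a Uy).
rewrite /riemann.
rewrite (is_derive_unique_on oU Uy (fun z _ => christoffel_alongP k b c z) d1 d2).
rewrite (derive_linear _ _ _ (christoffel_along_diff a Uy)) christoffel_alongP.
rewrite mulmxDl mulmxDr -scalemxAl -scalemxAr.
move: ('D_a (Gm b) y) ('D_a (Gm c) y) ('D_b (Gm a) y) ('D_c (Gm a) y) => A B C D.
move: (Gm b y *m _) (Gm c y *m _) (Gm a y *m Gm b y) (Gm a y *m _) => A' B' C' D'.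
by apply/matrixP => i j; rewrite !mxE; ring.
Qed.

Lemma riemann_vecE a b v : v *m riemann a b y =
  v *m 'D_a (Gm b) y - v *m 'D_b (Gm a) y + v *m Gm b y *m Gm a y - v *m Gm a y *m Gm b y.
Proof. by rewrite /riemann mulmxBr mulmxDr mulmxBr !mulmxA. Qed.

Lemma derive_torsion_free d a b : b *m 'D_d (Gm a) y = a *m 'D_d (Gm b) y.
Proof.
exact: (is_derive_unique_on oU Uy (fun z Uz => torsion_free a b Uz)
  (is_derive_mulcl b (is_derive_christoffel a d Uy))
  (is_derive_mulcl a (is_derive_christoffel b d Uy))).
Qed.

Lemma riemann_bianchi a b c :
  c *m riemann a b y + a *m riemann b c y + b *m riemann c a y = 0.
Proof.
rewrite !riemann_vecE (derive_torsion_free a b c) (derive_torsion_free b a c).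
rewrite (derive_torsion_free c b a).
rewrite (torsion_free b c Uy) (torsion_free a c Uy) (torsion_free a b Uy).
move: ('D_a (Gm c) y) ('D_b (Gm c) y) ('D_c (Gm a) y) => A B C.
move: (b *m A) (a *m B) (b *m C) => v1 v2 v3.
move: (b *m Gm c y *m Gm a y) (a *m Gm c y *m Gm b y) (a *m Gm b y *m Gm c y) => v4 v5 v6.
by apply/rowP => j; rewrite !mxE; ring.
Qed.

(** [bilin_metric] is differentiated once more; second derivatives of [G] commute, so the part skew
    in [a] and [b] leaves only curvature. *)
Lemma riemann_skew a b u v : g (u *m riemann a b y) v = - g u (v *m riemann a b y).
Proof.
have D d e : bilin ('D_d ('D_e G) y) u v =
    g (u *m Gm e y *m Gm d y) v + g (u *m Gm e y) (v *m Gm d y)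
    + g (u *m 'D_d (Gm e) y) v
    + (g (u *m Gm d y) (v *m Gm e y) + g u (v *m Gm e y *m Gm d y)
    + g u (v *m 'D_d (Gm e) y)).
  move: ('D_d ('D_e G) y) (smooth_is_derive d (smooth_derive e sG) Uy) => X dX.
  have dL := is_derive_bilin_cst u v dX.
  have dG := is_derive_metric d Uy; have dE := is_derive_christoffel e d Uy.
  have dR := is_deriveD (is_derive_bilinl v dG (is_derive_mulcl u dE))
    (is_derive_bilinr u dG (is_derive_mulcl v dE)).
  have := is_derive_unique_on oU Uy (fun z Uz => bilin_metric e u v Uz) dL dR.
  by rewrite (bilin_metric d (u *m Gm e y) v Uy) (bilin_metric d u (v *m Gm e y) Uy).
have := D a b; rewrite (mx_schwarz b a oU Uy sG) D.
rewrite !riemann_vecE !(bilinDl, bilinDr, bilinNl, bilinNr).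
move: ('D_a (Gm b) y) ('D_b (Gm a) y) => A B; lra.
Qed.

(** The Ricci identity for [nabla xi_i = - eps phi] gives [- eps] times
    [(nabla_a phi) b - (nabla_b phi) a], where the multiples of [xib] cancel by symmetry of [g]. *)
Lemma riemann_xi i a b : xi i y *m riemann a b y =
  eps i y *: (g a (xib y) *: (b *m phi y *m phi y) - g b (xib y) *: (a *m phi y *m phi y)).
Proof.
(* Needed at every [z] of [U], since this formula is differentiated next. *)
have Dxi d z : U z -> 'D_d (xi i) z = - (eps i z *: (d *m phi z)) - xi i z *m Gm d z.
  move=> Uz; have := nabla_xi_at Uz i d; rewrite nabla_frameE// scaleNr => <-.
  by rewrite addrK.
have D d e : 'D_d ('D_e (xi i)) y =
    - (eps i y *: (e *m 'D_d phi y))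
    - ((- (eps i y *: (d *m phi y)) - xi i y *m Gm d y) *m Gm e y
       + xi i y *m 'D_d (Gm e) y).
  move: ('D_d ('D_e (xi i)) y) (smooth_is_derive d (smooth_derive e (sxi i)) Uy).
  move=> X dL; have dR := is_deriveB
    (is_deriveN (is_derive_scalemx (is_derive_eps i d Uy)
       (is_derive_mulcl e (is_derive_phi d Uy))))
    (is_derive_mulmx (is_derive_xi i d Uy) (is_derive_christoffel e d Uy)).
  have := is_derive_unique_on oU Uy (fun z Uz => Dxi e z Uz) dL dR.
  by rewrite scale0r add0r (Dxi d).
have h : xi i y *m riemann a b y =
    - eps i y *: (b *m nabla_endo a y - a *m nabla_endo b y).
  have := D a b; rewrite (mx_schwarz b a oU Uy (sxi i)) D.
  rewrite riemann_vecE !nabla_endoE (torsion_free b a Uy) !mulmxBl !mulNmx -!scalemxAl.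
  move: ('D_a (Gm b) y) ('D_b (Gm a) y) ('D_a phi y) ('D_b phi y) => A B C D'.
  move: (xi i y *m A) (xi i y *m B) (a *m D') (b *m C) => v1 v2 v3 v4.
  move: (xi i y *m Gm b y *m Gm a y) (xi i y *m Gm a y *m Gm b y) => v5 v6.
  move: (a *m phi y *m Gm b y) (b *m phi y *m Gm a y) (b *m Gm a y *m phi y) => v7 v8 v9.
  move: (eps i y) => e /rowP h; apply/rowP => j; have := h j; rewrite !mxE; lra.
rewrite h !(nabla_phi_at Uy i) (bilinC (b *m phi y) _ (Gsym Uy)).
move: (_ *: xib y) (_ *: (a *m phi y *m phi y)) (_ *: (b *m phi y *m phi y)) => v1 v2 v3.
by move: (eps i y) => e; apply/rowP => j; rewrite !mxE; ring.
Qed.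

Lemma curv_atE a b v : curv_at Gam y a b v = v *m riemann a b y.
Proof.
have C d e : cov Gam (cst d) (cov Gam (cst e) (cst v)) y =
    v *m 'D_d (Gm e) y + v *m Gm e y *m Gm d y.
  have -> : cov Gam (cst e) (cst v) = (fun z => v *m Gm e z).
    by apply/funext => z; rewrite cov_cst.
  by rewrite covE; case: (is_derive_mulcl v (is_derive_christoffel e d Uy)) => _ ->.
have C0 : cov Gam (lie (cst a) (cst b)) (cst v) y = 0.
  rewrite /cov derive_cst add0r big1// => i _.
  by rewrite lie_cst mxE scale0r.
rewrite /curv_at /curvature !C C0 subr0 riemann_vecE.
move: ('D_a (Gm b) y) ('D_b (Gm a) y) => A B.
move: (v *m A) (v *m B) (v *m Gm b y *m _) (v *m Gm a y *m _) => v1 v2 v3 v4.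
by apply/rowP => j; rewrite !mxE; ring.
Qed.

Lemma jacobi_mxE v a : a *m jacobi_mx Gam y v = v *m riemann a v y.
Proof.
rewrite linear_lin1_mx => [|k b c]; first exact: curv_atE.
rewrite !curv_atE riemann_alt riemannP [riemann b v y]riemann_alt [riemann c v y]riemann_alt.
by rewrite !mulmxN scalerN -opprD mulmxDr -scalemxAr.
Qed.

Lemma null_and_spacelike_jacobi (i1 : 'I_s) : eps i1 y = -1 ->
  exists kv ku : complex R -> nat, forall v, (v <= phi y)%MS -> g v v = 1 ->
  exists f : complex R -> nat, forall l,
    (eigenmult (perp_op (G y) (jacobi_mx Gam y v) v) l + mup l 'X = f l + kv l)%N /\
    (mup l 'X + (eigenmult (bar_op (G y) (jacobi_mx Gam y (xi i1 y + v)) (xi i1 y + v)) l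
                 + mup l 'X) = f (l - 1)%R + ku l)%N.
Proof.
(* The witnesses are left open before [v] appears, so they cannot depend on it: they become the
   multiplicities of [Kv] and [Ku], which involve only the signs at [y]. *)
move=> i1E; eexists; eexists => v vphi v1.
apply: (jacobi_eigenmult (Gsym Uy) (Gunit Uy) (phi_rk Uy) (phi2 Uy) (eta_xi1 Uy)
  (eps1 Uy) (compat Uy) (Rm := fun a b => riemann a b y)) => //.
- by move=> a b c; have := riemannP 1 a b c; rewrite !scale1r.
- exact: riemann_alt.
- exact: riemann_bianchi.
- by move=> *; exact: riemann_skew.
- exact: riemann_xi.
- exact: jacobi_mxE.
- exact: jacobi_mxE.
Qed.

End RiemannAtPoint.
End Chart.

(** * From the multiplicity identities to the equivalence *)

Theorem proposition3p4 (R : realType) (n s : nat) (hs : (0 < s)%N)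
    (M : manifold R (2 * n + s)%N) (F : gff M) (g : pseudo_metric M)
    (nabla : connection M) (p : M) (c : chart M) :
  lorentzian_S_manifold F g hs -> levi_civita g nabla -> dom c p ->
  phi_null_osserman F g nabla c p hs <->
  jacobi_eigenvalues_independent F g nabla c p.
Proof.
move=> [[compat normalF contactF] _ timelike] [torsion metricg] cp.
pose x := Defs.coord c p.
have Ux : cod c x by exists p.
have cst_smooth (a : 'rV[R]_(2 * n + s)) : smooth_on (cod c) (fun=> a).
  exact: smooth_cst.
have eps1 : eps F g (xi1 hs) c x = -1.
  by have := timelike c _ Ux; case: ((compat c _ Ux).1 (xi1 hs)) => ->; rewrite // ltr10.
have [kv [ku key]] := null_and_spacelike_jacobi (@cod_open _ _ M c)
  ((Defs.metric_tensor g).1 c) ((phi_tensor F).1 c) (fun a => (xi_field F a).1 c)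
  (fun a => (eta_form F a).1 c) (@christoffel_smooth _ _ _ nabla c)
  (@Defs.metric_sym _ _ _ g c) (@Defs.metric_nondeg _ _ _ g c) (@phi_rank _ _ _ _ F c)
  (@phi_sq _ _ _ _ F c) (@eta_xi _ _ _ _ F c) (fun y Uy => (compat c y Uy).1)
  (fun y Uy => (compat c y Uy).2)
  (fun a b => normalF c _ _ (cst_smooth a) (cst_smooth b))
  (fun i a b => contactF i c _ _ (cst_smooth a) (cst_smooth b))
  (fun a b => torsion c _ _ (cst_smooth a) (cst_smooth b))
  (fun a b d => metricg c _ _ _ (cst_smooth a) (cst_smooth b) (cst_smooth d))
  Ux eps1.
have {}key v : celestial_sphere F g c p v -> exists f : complex R -> nat, forall l,
    (eigenmult (jacobi_op g nabla c p v) l + mup l 'X = f l + kv l)%N /\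
    (mup l 'X + (eigenmult (null_jacobi_op g nabla c p (xi F (xi1 hs) c x + v)) l
                 + mup l 'X) = f (l - 1)%R + ku l)%N.
  by move=> Sv; exact: (key v Sv.1 Sv.2).
split=> [null y v v' Sv Sv' l | jac u u' [v Sv ->] [v' Sv' ->] l].
  have [f fE] := key v Sv; have [f' f'E] := key v' Sv'.
  (* At [l + 1] the null operator sees the value of [f] at [l]. *)
  have := null _ _ (ex_intro2 _ _ v Sv erefl) (ex_intro2 _ _ v' Sv' erefl) (l + 1).
  move: (fE (l + 1)).2 (f'E (l + 1)).2 (fE l).1 (f'E l).1; rewrite addrK.
  move=> h1 h2 h3 h4 h5.
  have ff' : f l = f' l.
    by apply/eqP; rewrite -(eqn_add2r (ku (l + 1))) -h1 -h2 h5.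
  by apply/eqP; rewrite -(eqn_add2r (mup l 'X)) h3 h4 ff'.
have [f fE] := key v Sv; have [f' f'E] := key v' Sv'.
(* Conversely, the null operator at [l] needs [f] at [l - 1]. *)
have h := jac v v' Sv Sv' (l - 1).
have ff' : f (l - 1) = f' (l - 1).
  by apply/eqP; rewrite -(eqn_add2r (kv (l - 1))) -(fE _).1 -(f'E _).1 h.
apply: (@addIn (mup l 'X)); apply: (@addnI (mup l 'X)).
by apply: etrans (fE l).2 _; rewrite ff'; apply/esym; exact: (f'E l).2.
Qed.
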